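(* Fix true travel times $\tau\in\mathbb Q^m_{\ge0}$ and a horizon $T>0$, and let $f$ be any dynamic equilibrium with respect to $\tau$. Then the infimum $\inf\{\overline M(\tau'):\tau'\in\mathbb R^m_{\ge0}\}$ is attained and $$M_T(f)=\underline M(\tau)=\overline M(\tau)=\min\{\overline M(\tau'):\tau'\in\mathbb R^m_{\ge0}\}.$$
   Context: Parallel-link dynamic flow model. Fix $m\in\mathbb N$, capacities $\nu_1,\dots,\nu_m\in\mathbb Q_{>0}$ and an inflow rate $u\in\mathbb Q_{>0}$; $[m]=\{1,\dots,m\}$, $[x]^+=\max\{x,0\}$. A flow is a family $f=(f_i)_{i\in[m]}$ of measurable $f_i:\mathbb R_{\ge0}\to\mathbb R_{\ge0}$ with $\sum_i f_i(\theta)=u$ for a.e. $\theta\ge0$. The queue length $z_i(\theta;f)$ of link $i$ is the absolutely continuous function with $z_i(0)=0$ and, for a.e. $\theta$, $z_i'(\theta)=f_i(\theta)-\nu_i$ if $z_i(\theta)>0$ and $z_i'(\theta)=[f_i(\theta)-\nu_i]^+$ if $z_i(\theta)=0$ (it depends only on $f$). A flow $f$ is a dynamic equilibrium w.r.t. travel times $\tau'\in\mathbb R^m_{\ge0}$ if for a.e. $\theta\ge0$, every $i$ with $f_i(\theta)>0$ satisfies $\theta+z_i(\theta;f)/\nu_i+\tau'_i=\min_j(\theta+z_j(\theta;f)/\nu_j+\tau'_j)$. Let $\mathcal F(\tau')$ be the set of all dynamic equilibria w.r.t. $\tau'$. Canonical flow for travel times $\sigma_1\le\dots\le\sigma_m$: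 $\bar\nu(i)=\sum_{j=1}^i\nu_j$, $\bar\nu(0)=0$; $\theta^*_1=0$, $\theta^*_{i+1}=\theta^*_i+\frac{\bar\nu(i)}{u-\bar\nu(i)}(\sigma_{i+1}-\sigma_i)$ if $\bar\nu(i)<u$ and $\infty$ otherwise ($i=1,\dots,m-1$), $\theta^*_{m+1}=\infty$; $k=\max\{j\in\{0,\dots,m\}:\bar\nu(j)<u\}$; $f_i(\theta)=\frac{u}{\bar\nu(j)}\nu_i$ if $i\le k$ and $\theta\in[\theta^*_j,\theta^*_{j+1})$ for some $j\in\{i,\dots,k\}$; $f_i(\theta)=\nu_i$ if $i\le k$, $\theta\ge\theta^*_{k+1}$; $f_{k+1}(\theta)=u-\bar\nu(k)$ if $k<m$, $\theta\ge\theta^*_{k+1}$; $0$ otherwise. Misperceived travel times: given the true travel times $\tau$ and any $\tau'\in\mathbb R^m_{\ge0}$, let $f^{\tau'}$ be the canonical flow for the travel times $\tau'$, where links are relabeled so that $\tau'$ is non-decreasing, ties in $\tau'$ broken in favor of smaller true $\tau_i$ (remaining ties by index). For a flow $f$, true exit times are $T_i(\theta;f)=\theta+z_i(\theta;f)/\nu_i+\tau_i$ and the makespan is $M_T(f)=\sup\{T_i(\theta;f):\theta\in[0,T],i\in[m], f_i(\theta)>0\}$. Define $\underline M(\tau'):=M_T(f^{\tau'})$ and $\overline M(\tau'):=\sup\{M_T(f'):f'\in\mathcal F(\tau')\}$.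
   Formalization: The supremum over θ∈[0,T] in the makespan M_T is taken as an essential supremum (ignoring null sets of θ); with the pointwise supremum the claim fails, since an equilibrium may be altered at a single time to use a very slow link. *)

(* Defs.v *)
From HB Require Import structures.
From mathcomp Require Import all_boot all_order all_algebra.
From mathcomp Require Import all_classical all_reals all_analysis.
Set Implicit Arguments. Unset Strict Implicit. Unset Printing Implicit Defensive.
Import Order.TTheory GRing.Theory Num.Theory.
Import numFieldNormedType.Exports.
Local Open Scope classical_set_scope.
Local Open Scope ring_scope.

Section ParallelLinks.
Variables (R : realType) (m : nat).
Implicit Types (nu tau taup : 'I_m -> R) (u : R) (f : 'I_m -> R -> R).

Local Notation leb_mu := (@lebesgue_measure R).

Definition abs_cont_on (a b : R) (z : R -> R) : Prop :=
  forall e : R, 0 < e -> exists2 d : R, 0 < d &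
    forall (n : nat) (A B : nat -> R),
      (forall k, (k < n)%N -> a <= A k /\ A k <= B k /\ B k <= b) ->
      (forall k l, (k < n)%N -> (l < n)%N -> k <> l -> B k <= A l \/ B l <= A k) ->
      \sum_(k < n) (B k - A k) < d ->
      \sum_(k < n) `|z (B k) - z (A k)| < e.

Definition is_flow u f : Prop :=
  (forall i, measurable_fun [set x : R | 0 <= x] (f i)) /\
  (forall i (t : R), 0 <= t -> 0 <= f i t) /\
  {ae leb_mu, forall t : R, 0 <= t -> \sum_(i < m) f i t = u}.

Definition is_queue nu f (i : 'I_m) (z : R -> R) : Prop :=
  z 0 = 0 /\
  (forall b : R, 0 < b -> abs_cont_on 0 b z) /\
  {ae leb_mu, forall t : R, 0 < t ->
      derivable z t 1 /\
      ((0 < z t /\ derive1 z t = f i t - nu i) \/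
       (z t = 0 /\ derive1 z t = Num.max (f i t - nu i) 0))}.

(* z_i(.; f): the (unique) function satisfying is_queue. *)
Definition queue nu f (i : 'I_m) : R -> R :=
  xget (fun _ : R => 0) [set z | is_queue nu f i z].

Definition exit_time nu tt f (i : 'I_m) (t : R) : R :=
  t + queue nu f i t / nu i + tt i.

Definition is_equilibrium nu u taup f : Prop :=
  is_flow u f /\
  {ae leb_mu, forall t : R, 0 <= t -> forall i, 0 < f i t ->
     ((exit_time nu taup f i t)%:E =
        \big[Order.min/+oo%E]_(j < m) (exit_time nu taup f j t)%:E)%E}.

Definition equilibria nu u taup : set ('I_m -> R -> R) :=
  [set f | is_equilibrium nu u taup f].

(* Makespan M_T(f), with the supremum over theta taken essentially. *)
Definition makespan nu tau (T : R) f : \bar R :=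
  ereal_inf [set M : \bar R | {ae leb_mu, forall t : R, 0 <= t <= T ->
     forall i, 0 < f i t -> ((exit_time nu tau f i t)%:E <= M)%E}].

Definition link_le tau taup (i j : 'I_m) : bool :=
  (taup i < taup j) ||
  ((taup i == taup j) &&
   ((tau i < tau j) || ((tau i == tau j) && (i <= j)%N))).

Definition sorted_links tau taup : seq 'I_m := sort (link_le tau taup) (enum 'I_m).

Definition pos tau taup (i : 'I_m) : nat := (index i (sorted_links tau taup)).+1.

Definition sig tau taup (p : nat) : R := nth 0 (map taup (sorted_links tau taup)) p.-1.
Definition nus nu tau taup (p : nat) : R := nth 0 (map nu (sorted_links tau taup)) p.-1.

Definition nubar nu tau taup (i : nat) : R := \sum_(1 <= p < i.+1) nus nu tau taup p.

(* theta*_p for p = 1 .. m+1 (index 0 unused) *)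
Fixpoint thstar nu u tau taup (p : nat) : \bar R :=
  match p with
  | 0 => 0%E
  | 1 => 0%E
  | S i =>
      if (i < m)%N && (nubar nu tau taup i < u) then
        (thstar nu u tau taup i +
          (nubar nu tau taup i / (u - nubar nu tau taup i) *
             (sig tau taup i.+1 - sig tau taup i))%:E)%E
      else +oo%E
  end.

Definition kidx nu u tau taup : nat :=
  \max_(j < m.+1 | nubar nu tau taup j < u) (j : nat).

Definition canonical_flow nu u tau taup : 'I_m -> R -> R :=
  fun i t =>
  let p := pos tau taup i in
  let k := kidx nu u tau taup in
  let th := thstar nu u tau taup in
  let nb := nubar nu tau taup in
  if (p <= k)%N then
    (if (th k.+1 <= t%:E)%E then nu i
     else \sum_(p <= j < k.+1)
            (if ((th j <= t%:E)%E && (t%:E < th j.+1)%E)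
             then u / nb j * nu i else 0))
  else if (p == k.+1) && (k < m)%N && (th k.+1 <= t%:E)%E then u - nb k
  else 0.

Definition lower_makespan nu u tau T taup : \bar R :=
  makespan nu tau T (canonical_flow nu u tau taup).

Definition upper_makespan nu u tau T taup : \bar R :=
  ereal_sup [set makespan nu tau T f' | f' in equilibria nu u taup].

End ParallelLinks.

(* Main.v *)
(* In an equilibrium for perceived travel times tau, all used links share the
   perceived exit time E t = min_j (t + z_j t / nu_j + tau_j), and the queues are
   z_i = nu_i [E t - t - tau_i]^+.  As E is nondecreasing, the makespan of an
   equilibrium for the true tau is at most E T.

   Conversely let f' be an equilibrium for tau' with exit time E', and suppose
   that every particle of f' truly exits by M < E T.  Put d = M - E' T, so that
   E - E' exceeds d at time T.  A link i used by f' whose tau'_i is below the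
   final perceived delay still has its last particle's exit time, hence
   tau_i <= tau'_i + d.  While E - E' > d, every link used by f' therefore has
   tau_i < E t - t, so f' spreads the inflow over no more capacity than f, and
   its delay grows at least as fast.  Going back in time, E - E' only increases
   and the perceived delay of f' only decreases, down to time 0, where
   E 0 = min tau <= min tau' + d = E' 0 + d, a contradiction.

   So E T is the makespan of every equilibrium for tau and a lower bound for
   every equilibrium for any tau'.  The canonical flow shows that an equilibrium
   exists for each tau'. *)

Require Import Defs.
From HB Require Import structures.
From mathcomp Require Import all_boot all_order all_algebra.
From mathcomp Require Import all_classical all_reals all_analysis.
From mathcomp Require Import measurable_realfun ring lra.
Import Order.TTheory GRing.Theory Num.Theory.
Set Implicit Arguments. Unset Strict Implicit. Unset Printing Implicit Defensive.
Import numFieldNormedType.Exports.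
Local Open Scope classical_set_scope.
Local Open Scope ring_scope.

(** * Real analysis *)

Section RealLine.
Variable R : realType.
Implicit Types (z g : R -> R) (P : R -> Prop).

(** Take the supremum of the points up to which [P] holds throughout. The limit hypothesis gives [P]
    there too, and the step hypothesis would push past it if it lay below [t]. *)
Lemma real_induction (a b : R) P : P a ->
  (forall t, a <= t < b -> P t ->
     exists2 r : R, 0 < r & forall s, t < s < t + r -> s <= b -> P s) ->
  (forall t, a < t <= b -> (forall s, a <= s < t -> P s) -> P t) ->
  forall t, a <= t <= b -> P t.
Proof.
move=> Pa Pstep Plim t /andP[at_ tb].
pose S := [set x | a <= x <= t /\ forall s, a <= s <= x -> P s].
have Sa : S a.
  by split=> [|s /andP[? ?]]; [rewrite lexx|have -> : s = a by lra].
have uS : ubound S t by move=> x [/andP[]].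
have hS : has_sup S by split; [exists a|exists t].
have at' : a <= sup S by apply: ub_le_sup => //; exists t.
have supt : sup S <= t by apply: ge_sup => //; exists a.
have Plt s : a <= s < sup S -> P s.
  move=> /andP[as_ ss]; have [x [_ Px] sx] := sup_gt (proj1 hS) ss.
  by apply: Px; rewrite as_ ltW.
have Psup : P (sup S).
  have [<-//|ne] := eqVneq a (sup S).
  by apply: Plim => //; rewrite lt_neqAle ne at' (le_trans supt tb).
have [st|ts] := ltP (sup S) t; last first.
  by have -> : t = sup S by apply/eqP; rewrite eq_le ts supt.
have [|r r0 Pr] := Pstep (sup S) _ Psup; first by rewrite at' (lt_le_trans st).
(* A point beyond [sup S] but still inside the window given by [Pstep] and below [t]; it belongs to
   [S], which is absurd. *)
pose x := Num.min t (sup S + r / 2).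
have sx : sup S < x by rewrite /x lt_min st /=; lra.
have xt : x <= t by rewrite /x ge_min lexx.
have xr : x <= sup S + r / 2 by rewrite /x ge_min lexx orbT.
suff /(ub_le_sup (ex_intro _ t uS)) : S x by lra.
split=> [|s /andP[as_ sx']]; first by rewrite xt; lra.
have [ss|] := ltP s (sup S); first by apply: Plt; rewrite as_.
rewrite le_eqVlt => /predU1P[<-//|ss].
by apply: Pr; [lra|lra].
Qed.

(** The point is the supremum of the failures of [P]; as [P] is relatively open, that supremum is
    itself a failure. Later uses isolate the final stretch on which a strict inequality holds. *)
Lemma last_exit (a t : R) P : a <= t -> ~ P a -> P t ->
  (forall s, a <= s <= t -> P s -> exists2 r : R, 0 < r &
     forall s', a <= s' <= t -> `|s' - s| < r -> P s') ->
  exists2 s0, a <= s0 < t & ~ P s0 /\ forall s, s0 < s <= t -> P s.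
Proof.
move=> at_ nPa Pt oP.
pose S := [set x | a <= x <= t /\ ~ P x].
have Sa : S a by split=> //; rewrite lexx.
have uS : ubound S t by move=> x [/andP[]].
have hS : has_sup S by split; [exists a|exists t].
have at' : a <= sup S by apply: ub_le_sup => //; exists t.
have supt : sup S <= t by apply: ge_sup => //; exists a.
have nPs : ~ P (sup S).
  move=> Ps; have [|r r0 Hr] := oP _ _ Ps; first by rewrite at' supt.
  have [x [/andP[ax xt] nPx] sx] := sup_adherent r0 hS; apply: (nPx).
  have Sx : S x := conj (introT andP (conj ax xt)) nPx.
  have xs : x <= sup S by apply: ub_le_sup Sx; exists t.
  by apply: Hr; [rewrite ax|rewrite ltr_norml; apply/andP; split; lra].
exists (sup S).
  by rewrite at' lt_neqAle supt andbT; apply/eqP => E; rewrite E in nPs.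
split=> // s /andP[ss st]; apply: contrapT => nP.
have : s <= sup S.
  by apply: ub_le_sup; [exists t|split=> //; rewrite st (le_trans at')//ltW].
by lra.
Qed.

(** Division-free form of the derivative: [h = 0] needs no exclusion and the estimates become linear
    arithmetic. *)
Lemma derivable_approxP z (t d : R) :
  (derivable z t 1 /\ derive1 z t = d) <->
  (forall e : R, 0 < e -> exists2 r : R, 0 < r &
     forall h, `|h| < r -> `|z (t + h) - z t - d * h| <= e * `|h|).
Proof.
have key : (derivable z t 1 /\ derive1 z t = d) <->
    (fun h => h^-1 *: ((z \o shift t) (h *: (1:R)) - z t)) h @[h --> (0:R)^'] --> d.
  split=> [[dz <-]|cz].
    by rewrite derive1E; exact: dz.
  split; first by apply/cvg_ex; exists d.
  by rewrite derive1E; apply/cvg_lim => //; exact: Rhausdorff.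
rewrite key; split=> [cz e e0|H].
  move/cvgrPdist_le : cz => /(_ _ e0) [r /= r0 Hr].
  exists r => // h hr; have [->|h0] := eqVneq h 0.
    by rewrite addr0 subrr mulr0 subrr normr0 mulr0.
  have := Hr h; rewrite /= sub0r normrN => /(_ hr h0).
  have hn : 0 < `|h| by rewrite normr_gt0.
  rewrite -(ler_pM2r hn) -normrM /shift /= [h *: _]mulr1 (addrC h t).
  by rewrite distrC /GRing.scale /=; congr (`|_| <= _); field; exact: h0.
apply/cvgrPdist_le => e e0; have [r r0 Hr] := H _ e0.
exists r => // h; rewrite /ball_ /= sub0r normrN => hr h0.
have hn : 0 < `|h| by rewrite normr_gt0.
rewrite -(ler_pM2r hn) -normrM /shift /= [h *: _]mulr1 (addrC h t).
have := Hr _ hr; rewrite distrC /GRing.scale /=.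
by congr (`|_| <= _); field; exact: h0.
Qed.

End RealLine.

(** * Monotonicity of absolutely continuous functions *)

Section AbsCont.
Variable R : realType.
Implicit Types (g : R -> R).
Local Notation mu := (@lebesgue_measure R).

(* The exceptional null set is covered by an open set U of measure smaller than
   the modulus d of absolute continuity.  Real induction glues together intervals
   on which g grows with slope at most e and intervals contained in U, over which
   the total increase is less than e. *)
Lemma abs_cont_nonincr (a b : R) g : a <= b -> abs_cont_on a b g ->
  {ae mu, forall t : R, a < t < b -> derivable g t 1 /\ derive1 g t <= 0} ->
  g b <= g a.
Proof.
move=> ab ac [N [mN N0 HN]].
suff key e : 0 < e -> g b - g a <= e * (b - a) + e.
  apply/ler_addgt0Pr => e e0.
  have ba : 0 < b - a + 1 by lra.
  have := key (e / (b - a + 1)) (divr_gt0 e0 ba).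
  have -> : e / (b - a + 1) * (b - a) + e / (b - a + 1) = e.
    by field; rewrite gt_eqF.
  by lra.
move=> e0; have [d d0 Hd] := ac _ e0.
(* The endpoints join the null set because the derivative is controlled on the open interval
   only. *)
pose N' : set R := N `|` [set a] `|` [set b].
have mN' : measurable N' by apply: measurableU => //; apply: measurableU.
have N'0 : mu N' = 0%E.
  rewrite measureU0//; last exact: lebesgue_measure_set1.
    by rewrite measureU0//; last exact: lebesgue_measure_set1.
  exact: measurableU.
have [|U [oU NU muU]] := lebesgue_regularity_outer mN' _ d0.
  by rewrite [X in (X < _)%E]N'0 ltry.
have mU : measurable U by exact: open_measurable.
have muUd : (mu U < d%:E)%E.
  apply: le_lt_trans muU.
  have {1}-> : U = (U `\` N') `|` N'.
    by apply/seteqP; split=> x; [have [|] := pselect (N' x); [right|left]|move=> [[]//|/NU]].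
  rewrite measureU0//; exact: measurableD.
pose UU t : set R := U `&` `]a, t].
have mUU t : measurable (UU t) by apply: measurableI.
have UUU t : (mu (UU t) <= mu U)%E.
  by apply: le_measure; rewrite ?inE; [exact: mUU|exact: mU|exact: subIsetl].
have UUfin t : mu (UU t) \is a fin_num.
  by rewrite ge0_fin_numE//; apply: le_lt_trans (UUU t) (lt_trans muUd (ltry d)).
(* The budget available up to [t] for the total length of the intervals spent inside [U]. *)
pose m t := fine (mu (UU t)).
have m_mono s t : s <= t -> m s <= m t.
  move=> st; apply: fine_le => //; apply: le_measure; rewrite ?inE; [exact: mUU|exact: mUU|].
  move=> x [Ux]; rewrite /= !in_itv/= => /andP[ax xs]; split=> //=.
  by rewrite in_itv/= ax (le_trans xs).
have md t : m t < d.
  by rewrite -lte_fin fineK//; apply: le_lt_trans muUd.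
have m_add s t : a <= s -> s <= t -> (forall x, s < x <= t -> U x) ->
    m s + (t - s) <= m t.
  move=> as_ st Ust; rewrite -lee_fin EFinD fineK// fineK//.
  have <- : mu `]s, t] = (t - s)%:E.
    by rewrite lebesgue_measure_itv/= lte_fin; case: ltP => // ts; congr (_%:E); lra.
  rewrite -measureU; [|exact: mUU|by []|]; last first.
    apply/seteqP; split=> x //= [[_]]; rewrite /= !in_itv/= => /andP[_ xs] /andP[sx _].
    by lra.
  apply: le_measure; rewrite ?inE; [by apply: measurableU; [exact: mUU|exact: measurable_itv]|exact: mUU|].
  move=> x [[Ux]|]; rewrite /UU /= !in_itv/= => /andP[h1 h2].
    by split; [exact: Ux|rewrite h1 (le_trans h2)].
  split; first by apply: Ust; rewrite h1.
  by rewrite h2 (le_lt_trans as_ h1).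
(* The invariant of the real induction: up to [t], the increase of [g] beyond slope [e] is paid for
   by finitely many non-overlapping intervals whose lengths fit in the budget [m t]. *)
pose P t := exists n (A B : nat -> R),
  [/\ (forall k, (k < n)%N -> a <= A k /\ A k <= B k /\ B k <= t),
      (forall k l, (k < n)%N -> (l < n)%N -> k <> l -> B k <= A l \/ B l <= A k),
      \sum_(k < n) (B k - A k) <= m t
    & g t - g a <= e * (t - a) + \sum_(k < n) `|g (B k) - g (A k)| ].
suff : P b.
  move=> [n [A [B [H1 H2 H3 H4]]]].
  have := Hd n A B H1 H2 (le_lt_trans H3 (md b)).
  by lra.
(* Propagation across [t] from left to right; with [s1 = t] it is the step of the induction, with
   [s2 = t] its limit case. *)
have gauge t : a <= t <= b -> exists2 r : R, 0 < r &
    forall s1 s2, a <= s1 <= t -> t <= s2 <= b -> t - r < s1 -> s2 < t + r ->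
      P s1 -> P s2.
  move=> /andP[at_ tb]; have [N't|nN't] := pselect (N' t).
    have /nbhs_ballP[r r0 Hr] : nbhs t U by exact: open_nbhs_nbhs (conj oU (NU _ N't)).
    exists r => // s1 s2 /andP[as1 s1t] /andP[ts2 s2b] rs1 rs2.
    have Us x : s1 <= x <= s2 -> U x.
      by move=> /andP[? ?]; apply: Hr; rewrite /ball/= ltr_norml; apply/andP; split; lra.
    move=> [n [A [B [H1 H2 H3 H4]]]].
    (* Here [[s1, s2]] lies in [U], so it is appended to the family as interval number [n]. *)
    pose A' k := if (k < n)%N then A k else s1.
    pose B' k := if (k < n)%N then B k else s2.
    exists n.+1, A', B'; split.
    - move=> k _; rewrite /A' /B'; case: ifP => [/H1[h1 [h2 h3]]|_]; last by lra.
      by lra.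
    - move=> k l; rewrite !ltnS /A' /B' => kn ln kl.
      case: (ltnP k n) => hk; case: (ltnP l n) => hl.
      + exact: H2.
      + by left; have [_ []] := H1 _ hk.
      + by right; have [_ []] := H1 _ hl.
      + by exfalso; apply: kl; apply/eqP; rewrite eqn_leq (leq_trans kn)// (leq_trans ln).
    - rewrite big_ord_recr /= /A' /B' ltnn.
      rewrite (eq_bigr (fun k : 'I_n => B k - A k)); last by move=> k _; rewrite ltn_ord.
      have : m s1 + (s2 - s1) <= m s2.
        by apply: m_add => // [|x /andP[? ?]]; [lra|apply: Us; lra].
      by lra.
    - rewrite big_ord_recr /= /A' /B' ltnn.
      rewrite (eq_bigr (fun k : 'I_n => `|g (B k) - g (A k)|)); last first.
        by move=> k _; rewrite ltn_ord.
      have := ler_norm (g s2 - g s1).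
      have : e * (s1 - a) <= e * (s2 - a) by rewrite ler_pM2l; lra.
      by lra.
  have [ta tb' Nt] : [/\ t <> a, t <> b & ~ N t].
    by split=> h; apply: nN't; [left; right|right|left; left].
  have [dt d_le0] : derivable g t 1 /\ derive1 g t <= 0.
    apply: contrapT => h; apply: Nt; apply: HN => k; apply/h/k.
    by rewrite !lt_neqAle at_ tb !andbT; apply/andP; split; apply/eqP => //; exact: nesym.
  have [r r0 Hr] := (derivable_approxP g t (derive1 g t)).1 (conj dt erefl) e e0.
  exists r => // s1 s2 /andP[as1 s1t] /andP[ts2 s2b] rs1 rs2.
  move=> [n [A [B [H1 H2 H3 H4]]]]; exists n, A, B; split=> //.
  - by move=> k /H1[h1 [h2 h3]]; lra.
  - by apply: le_trans H3 _; apply: m_mono; lra.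
  - have h1 : `|s1 - t| < r by rewrite ltr_norml; apply/andP; split; lra.
    have h2 : `|s2 - t| < r by rewrite ltr_norml; apply/andP; split; lra.
    have := Hr _ h1; rewrite (addrC t) subrK [`|s1 - t|]ler0_norm; last by lra.
    have := Hr _ h2; rewrite (addrC t) subrK [`|s2 - t|]ger0_norm; last by lra.
    rewrite !ler_norml => /andP[_ k2] /andP[k1 _].
    have : derive1 g t * (s2 - t) <= 0 by rewrite mulr_le0_ge0//; lra.
    have : 0 <= derive1 g t * (s1 - t) by rewrite mulr_le0//; lra.
    have -> : e * (s2 - a) = e * (s1 - a) + e * (s2 - t) + e * - (s1 - t) by ring.
    by lra.
have Pa : P a.
  exists 0%N, (fun=> 0), (fun=> 0); split=> //.
    by rewrite big_ord0; apply: fine_ge0.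
  by rewrite big_ord0 !subrr mulr0 addr0.
apply: (real_induction (a := a) (b := b)) => //; last by rewrite ab lexx.
  move=> t /andP[at_ tb] Pt; have [|r r0 H] := gauge t; first by rewrite at_ ltW.
  exists r => // s /andP[ts sr] sb; apply: (H t s) => //; rewrite ?lexx ?at_ ?sb ?ltW//; lra.
move=> t /andP[at_ tb] H; have [|r r0 G] := gauge t; first by rewrite ltW.
have [s /andP[s1 s2]] : exists s, Num.max a (t - r) < s < t.
  exists ((Num.max a (t - r) + t) / 2).
  have : Num.max a (t - r) < t by rewrite gt_max at_; lra.
  by move=> ?; apply/andP; split; lra.
move: s1; rewrite gt_max => /andP[as_ rs].
apply: (G s t) => //; rewrite ?lexx ?tb ?(ltW as_) ?(ltW s2)//; first by lra.
by apply: H; rewrite ltW.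
Qed.

End AbsCont.

(** * Uniqueness of the queue *)

Section QueueUnique.
Variable R : realType.
Local Notation mu := (@lebesgue_measure R).

Lemma aeS (P Q : R -> Prop) : (forall t, P t -> Q t) ->
  {ae mu, forall t : R, P t} -> {ae mu, forall t : R, Q t}.
Proof. by move=> PQ; apply: (@filterS _ _ (ae_filter_ringOfSetsType mu)). Qed.

Lemma aeS2 (P1 P2 Q : R -> Prop) : (forall t, P1 t -> P2 t -> Q t) ->
  {ae mu, forall t : R, P1 t} -> {ae mu, forall t : R, P2 t} ->
  {ae mu, forall t : R, Q t}.
Proof. by move=> PQ; apply: (@filterS2 _ _ (ae_filter_ringOfSetsType mu)). Qed.

Lemma abs_cont_onS (a b a' b' : R) (g : R -> R) : a <= a' -> b' <= b ->
  abs_cont_on a b g -> abs_cont_on a' b' g.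
Proof.
move=> aa' bb' ac e /ac [d d0 H]; exists d => // n A B h1 h2 h3.
by apply: H => // k /h1 [? [? ?]]; lra.
Qed.

Lemma abs_cont_onB (a b : R) (f g : R -> R) :
  abs_cont_on a b f -> abs_cont_on a b g -> abs_cont_on a b (f - g).
Proof.
move=> acf acg e e0; have e20 : 0 < e / 2 by lra.
have [d1 d10 H1] := acf _ e20; have [d2 d20 H2] := acg _ e20.
exists (Num.min d1 d2); first by rewrite lt_min d10.
move=> n A B h1 h2; rewrite lt_min => /andP[/(H1 _ _ _ h1 h2) + /(H2 _ _ _ h1 h2)].
suff : \sum_(k < n) `|(f - g) (B k) - (f - g) (A k)| <=
  \sum_(k < n) `|f (B k) - f (A k)| + \sum_(k < n) `|g (B k) - g (A k)|.
  by lra.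
rewrite -big_split; apply: ler_sum => k _ /=; rewrite !fctE.
have -> : f (B k) - g (B k) - (f (A k) - g (A k)) =
  (f (B k) - f (A k)) - (g (B k) - g (A k)) by ring.
exact: ler_normB.
Qed.

Lemma abs_cont_on_cont (a b : R) (g : R -> R) : abs_cont_on a b g ->
  forall e : R, 0 < e -> exists2 r : R, 0 < r &
    forall s s', a <= s <= b -> a <= s' <= b -> `|s' - s| < r -> `|g s' - g s| < e.
Proof.
move=> ac e /ac [d d0 H]; exists d => //.
suff key s s' : a <= s <= b -> a <= s' <= b -> s <= s' -> `|s' - s| < d -> `|g s' - g s| < e.
  move=> s s' hs hs' d'; have [ss'|/ltW ss'] := leP s s'; first exact: key.
  by rewrite distrC; apply: key => //; rewrite distrC.
move=> /andP[? ?] /andP[? ?] ss'; rewrite [`|s' - s|]ger0_norm; last by lra.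
move=> sd; have := H 1%N (fun=> s) (fun=> s').
rewrite !big_ord_recl !big_ord0 !addr0; apply => //.
by move=> [|k] [|l].
Qed.

Variables (m : nat) (nu : 'I_m -> R) (f : 'I_m -> R -> R) (i : 'I_m).

(** On the last stretch where [y1] exceeds [y2], the larger queue is positive and has slope
    [f i s - nu i], which never exceeds the slope of [y2]. The difference thus cannot have risen
    above its starting value, which is at most 0. *)
Lemma is_queue_unique (z1 z2 : R -> R) : is_queue nu f i z1 -> is_queue nu f i z2 ->
  forall t, 0 <= t -> z1 t = z2 t.
Proof.
suff key y1 y2 : is_queue nu f i y1 -> is_queue nu f i y2 ->
    forall t, 0 <= t -> y1 t <= y2 t.
  by move=> h1 h2 t t0; apply/eqP; rewrite eq_le !key.
move=> [y10 [ac1 ae1]] [y20 [ac2 ae2]] t; rewrite le_eqVlt => /predU1P[<-|t0].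
  by rewrite y10 y20.
rewrite leNgt; apply/negP => lt.
have acw := abs_cont_onB (ac1 _ t0) (ac2 _ t0).
have [||||s0 /andP[s00 s0t] [/negP nP HP]] :=
    last_exit (a := 0) (t := t) (P := fun s => 0 < (y1 - y2) s).
- exact: ltW.
- by rewrite !fctE y10 y20 subrr ltxx.
- by rewrite !fctE subr_gt0.
- move=> s hs ws; have [r r0 Hr] := abs_cont_on_cont acw ws.
  exists r => // s' hs' /(Hr _ _ hs hs'); rewrite ltr_norml => /andP[+ _].
  by lra.
move: nP; rewrite -leNgt => nP.
have : (y1 - y2) t <= (y1 - y2) s0.
  apply: abs_cont_nonincr; [exact: ltW|exact: abs_cont_onS acw|].
  apply: aeS2 ae1 ae2 => s k1 k2 /andP[s0s st].
  have /k1[d1 {}k1] : 0 < s by lra.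
  have /k2[d2 {}k2] : 0 < s by lra.
  split; first exact: derivableB.
  rewrite derive1E deriveB// -!derive1E.
  have := HP s; rewrite s0s (ltW st) !fctE => /(_ isT).
  case: k1 => [[y1p ->]|[-> _]]; case: k2 => [[y2p ->]|[-> ->]] //; first by lra.
  - by move=> _; rewrite subr_le0 le_max lexx.
  - by lra.
  - by rewrite subrr ltxx.
have : 0 < (y1 - y2) t by rewrite !fctE subr_gt0.
by lra.
Qed.

End QueueUnique.

(** * Reflection and existence of queues *)

Section Lip.
Variable R : realType.
Implicit Types (L : R) (g h : R -> R).

(** The bound is asked on the whole line, without a side condition [0 <= s]; the reflection and the
    primitive below vanish at negative times and so satisfy it. *)
Definition lip L g := forall s t : R, s <= t -> `|g t - g s| <= L * (t - s).

Lemma lip_dist L g s t : lip L g -> `|g t - g s| <= L * `|t - s|.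
Proof.
move=> lg; have [st|/ltW ts] := leP s t.
  by rewrite [X in _ <= _ * X]ger0_norm ?subr_ge0// lg.
by rewrite distrC [X in _ <= _ * X]distrC [X in _ <= _ * X]ger0_norm ?subr_ge0// lg.
Qed.



Lemma lipD L L' g h : lip L g -> lip L' h -> lip (L + L') (fun t => g t + h t).
Proof.
move=> lg lh s t st; rewrite mulrDl; have := lg _ _ st; have := lh _ _ st.
have -> : g t + h t - (g s + h s) = (g t - g s) + (h t - h s) by ring.
have := ler_normD (g t - g s) (h t - h s); lra.
Qed.

Lemma lipN L g : lip L g -> lip L (fun t => - g t).
Proof. by move=> lg s t st; rewrite -opprD normrN lg. Qed.

Lemma lip_cst (c : R) : lip 0 (fun=> c).
Proof. by move=> s t st; rewrite subrr normr0 mul0r. Qed.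

Lemma lip_linear (c : R) : lip `|c| (fun t => c * t).
Proof. by move=> s t st; rewrite -mulrBr normrM [`|t - s|]ger0_norm// subr_ge0. Qed.

Lemma lip_near L g e : lip L g -> 0 < e -> exists2 r : R, 0 < r &
  forall s s', `|s' - s| < r -> `|g s' - g s| < e.
Proof.
move=> lg e0; have L0 : 0 <= L.
  by have := lg 0 1 ler01; rewrite subr0 mulr1; apply: le_trans.
exists (e / (L + 1)) => [|s s' hs]; first by rewrite divr_gt0//; lra.
apply: le_lt_trans (lip_dist s s' lg) _.
move: hs; rewrite ltr_pdivlMr; last by lra.
have := normr_ge0 (s' - s); nra.
Qed.

Lemma lip_abs_cont L g (a b : R) : lip L g -> abs_cont_on a b g.
Proof.
move=> lg e e0; have L0 : 0 <= L.
  by have := lg 0 1 ler01; rewrite subr0 mulr1; apply: le_trans.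
exists (e / (L + 1)) => [|n A B h1 _]; first by rewrite divr_gt0//; lra.
rewrite ltr_pdivlMr; last by lra.
have S0 : 0 <= \sum_(k < n) (B k - A k).
  by apply: sumr_ge0 => k _; have [_ [? _]] := h1 k (ltn_ord k); rewrite subr_ge0.
have : \sum_(k < n) `|g (B k) - g (A k)| <= L * \sum_(k < n) (B k - A k).
  rewrite mulr_sumr; apply: ler_sum => k _; have [_ [? _]] := h1 k (ltn_ord k).
  exact: lg.
by nra.
Qed.

Lemma lip_continuous L g : lip L g -> continuous g.
Proof.
move=> lg x; apply/cvgrPdist_lt => e e0; have [r r0 Hr] := lip_near lg e0.
exists r => // y; rewrite /ball_ /= => yr.
by rewrite Hr.
Qed.

End Lip.

(** * One-sided reflection of a Lipschitz path *)

Section Reflection.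
Variables (R : realType) (L : R) (X : R -> R).
Hypothesis lX : lip L X.

(* Skorokhod's one-sided reflection of the net input X at 0: X minus its running minimum. *)
Definition reflection (t : R) : R := sup [set X t - X s | s in [set s | 0 <= s <= t]].
Local Notation z := reflection.

Let L0 : 0 <= L.
Proof. by have := lX ler01; rewrite subr0 mulr1; apply: le_trans. Qed.

Lemma reflection_ge s t : 0 <= s <= t -> X t - X s <= z t.
Proof.
move=> /andP[s0 st]; apply: ub_le_sup; last by exists s => //=; rewrite s0.
exists (L * t) => _ [r /= /andP[r0 rt] <-].
apply: le_trans (ler_norm _) _; apply: le_trans (lX rt) _.
by rewrite ler_wpM2l//; lra.
Qed.

Lemma reflection_le t c : 0 <= t ->
  (forall s, 0 <= s <= t -> X t - X s <= c) -> z t <= c.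
Proof.
move=> t0 H; apply: ge_sup => [|_ [s hs <-]]; last exact: H.
by exists (X t - X 0), 0 => //=; rewrite lexx.
Qed.

(** At negative times the supremum runs over the empty set, whose [sup] is 0 by default. *)
Lemma reflection_neg t : t < 0 -> z t = 0.
Proof.
move=> t0; rewrite /reflection (_ : image _ _ = set0) ?sup0//.
by apply/seteqP; split=> [x [s /= /andP[? ?]]|x []]; lra.
Qed.

Lemma reflection_ge0 t : 0 <= z t.
Proof.
have [t0|t0] := ltP t 0; first by rewrite reflection_neg.
by have := @reflection_ge t t; rewrite subrr lexx t0; apply.
Qed.

Lemma reflection0 : z 0 = 0.
Proof.
apply/eqP; rewrite eq_le reflection_ge0 andbT; apply: reflection_le => // s /andP[? ?].
by have -> : s = 0; [lra|rewrite subrr].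
Qed.

(** Every starting point that competes in the supremum at [s] also competes at [t]. *)
Lemma reflection_incr s t : 0 <= s <= t -> X t - X s <= z t - z s.
Proof.
move=> /andP[s0 st]; suff : z s <= z t - (X t - X s) by lra.
apply: reflection_le => // r /andP[r0 rs].
have := @reflection_ge r t; rewrite r0 (le_trans rs)// => /(_ isT); lra.
Qed.

(** [r] is a minimizer of [X] on [[0, t]]; nothing before it is lower, so the reflection vanishes
    there. *)
Lemma reflection_attained t : 0 <= t -> exists2 r, 0 <= r <= t &
  z t = X t - X r /\ z r = 0.
Proof.
move=> t0; have [|r] := EVT_min t0 (f := X).
  exact: continuous_subspaceT (lip_continuous lX).
rewrite in_itv/= => /andP[r0 rt] Hr; exists r; first by rewrite r0.
split; apply/eqP; rewrite eq_le; apply/andP; split.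
- apply: reflection_le => // s hs; have := Hr s; rewrite in_itv/= => /(_ hs); lra.
- by apply: reflection_ge; rewrite r0.
- apply: reflection_le => // s /andP[s0 sr]; have := Hr s.
  by rewrite in_itv/= s0 (le_trans sr)// => /(_ isT); lra.
- exact: reflection_ge0.
Qed.

(** The minimizer for [t] is a zero of [z], so it lies at or before [s] and also competes in the
    supremum at [s]. *)
Lemma reflection_busy s t : 0 <= s <= t -> (forall r, s < r <= t -> 0 < z r) ->
  z t - z s = X t - X s.
Proof.
move=> /andP[s0 st] H; have [|r /andP[r0 rt] [zt zr]] := @reflection_attained t.
  exact: le_trans st.
apply/eqP; rewrite eq_le reflection_incr ?s0// andbT.
have rs : r <= s.
  by rewrite leNgt; apply/negP => sr; have := H r; rewrite sr rt zr ltxx => /(_ isT).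
by have := @reflection_ge r s; rewrite r0 rs => /(_ isT); lra.
Qed.

Lemma lip_reflection : lip L z.
Proof.
have pos s t : 0 <= s -> s <= t -> `|z t - z s| <= L * (t - s).
  move=> s0 st; rewrite ler_norml; apply/andP; split.
    have := @reflection_incr s t; rewrite s0 st => /(_ isT).
    by have := lX st; rewrite ler_norml => /andP[]; lra.
  suff : z t <= L * (t - s) + z s by lra.
  have zs := reflection_ge0 s.
  apply: reflection_le => [|r /andP[r0 rt]]; first exact: le_trans st.
  have [rs|sr] := leP r s.
    have := @reflection_ge r s; rewrite r0 rs => /(_ isT).
    by have := lX st; rewrite ler_norml => /andP[]; lra.
  have := lX rt; rewrite ler_norml => /andP[_].
  have : L * (t - r) <= L * (t - s) by rewrite ler_wpM2l//; lra.
  by lra.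
move=> s t st; have [s0|s0] := leP 0 s; first exact: pos.
have [t0|t0] := leP 0 t; last first.
  by rewrite !reflection_neg// subrr normr0 mulr_ge0// subr_ge0.
rewrite (reflection_neg s0) -reflection0; apply: le_trans (pos _ _ _ _) _ => //.
by rewrite ler_wpM2l//; lra.
Qed.

End Reflection.

(** * Primitives of bounded functions, and derivatives at zeros *)

Section Primitive.
Variable R : realType.
Local Notation mu := (@lebesgue_measure R).

Lemma primitive_exists (f : R -> R) (u : R) :
  measurable_fun [set x : R | 0 <= x] f -> (forall t, 0 <= t -> 0 <= f t) ->
  0 <= u -> {ae mu, forall t : R, 0 <= t -> f t <= u} ->
  exists F : R -> R, [/\ F 0 = 0, lip u F &
    {ae mu, forall t : R, 0 < t -> derivable F t 1 /\ derive1 F t = f t}].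
Proof.
move=> mf f0 u0 fu.
pose D : set R := [set x : R | 0 <= x].
have mD : measurable D.
  rewrite (_ : D = `[0, +oo[%classic); first exact: measurable_itv.
  by apply/seteqP; split=> x; rewrite /D /= in_itv/= andbT.
(* Cutting at [u] and extending by 0 makes the bound hold everywhere, hence [g] is integrable on
   sets of finite measure, while [g] agrees with [f] almost everywhere on positive times. *)
pose g := (f \min (cst u)) \_ D.
have mg : measurable_fun setT g.
  apply: (measurable_restrictT (f \min cst u) mD).1.
  by apply: measurable_minr => //; exact: measurable_cst.
have g0 x : 0 <= g x.
  by rewrite /g patchE; case: ifPn => // /set_mem xD; rewrite le_min f0.
have gu x : g x <= u.
  by rewrite /g patchE; case: ifPn => // _; rewrite ge_min lexx orbT.
have gf : {ae mu, forall t : R, 0 < t -> g t = f t}.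
  apply: aeS fu => t /= ft t0; rewrite /g patchE mem_set /D/=; last exact: ltW.
  by apply/min_idPl; apply: ft; exact: ltW.
have bg (A : set R) : [bounded g x | x in A].
  exists u; split; first exact: num_real.
  by move=> M uM x _ /=; rewrite ger0_norm// (le_trans (gu x))// ltW.
have ig (A : set R) : measurable A -> (mu A < +oo)%E -> mu.-integrable A (EFin \o g).
  by move=> mA Afin; apply: measurable_bounded_integrable => //; exact: measurable_funTS.
have muitv (a b : R) c d : (mu [set` Interval (BSide c a) (BSide d b)] < +oo)%E.
  by rewrite lebesgue_measure_itv/=; case: ifPn => // _; rewrite -EFinB ltry.
have lg : locally_integrable setT g.
  split=> //; first exact: openT.
  move=> K _ cK; have mK := compact_measurable cK.
  by have /integrableP[_] := ig K mK (compact_finite_measure cK).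
pose F (t : R) : R := \int[mu]_(x in `[0, t]) g x.
have Fneg t : t < 0 -> F t = 0.
  by move=> t0; rewrite /F set_itv_ge ?Rintegral_set0// bnd_simp -ltNge.
have F0 : F 0 = 0 by rewrite /F set_itv1 Rintegral_set1.
have lF0 s t : 0 <= s -> s <= t -> `|F t - F s| <= u * (t - s).
  move=> s0 st; rewrite /F Rintegral_itvB ?bnd_simp//; last exact: ig.
  rewrite ger0_norm; last by apply: Rintegral_ge0.
  apply: (@le_trans _ _ (\int[mu]_(x in `]s, t]) (cst u x))).
    apply: le_Rintegral => [//|||x _]; [exact: ig| |exact: gu].
    apply: measurable_bounded_integrable; [exact: measurable_itv|exact: muitv|exact: measurable_cst|].
    by exists u; split; [exact: num_real|move=> M uM x _ /=; rewrite ger0_norm// ltW].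
  rewrite Rintegral_cst// [X in fine X](_ : _ = (t - s)%:E)//.
  apply: etrans (lebesgue_measure_itv _) _; rewrite /= lte_fin.
  by case: ltP => // ts; congr (_%:E); lra.
exists F; split => //.
  move=> s t st; have [s0|s0] := leP 0 s; first exact: lF0.
  have [t0|t0] := leP 0 t; last first.
    by rewrite !Fneg// subrr normr0 mulr_ge0// subr_ge0.
  rewrite (Fneg s s0) -F0; apply: le_trans (lF0 _ _ _ _) _ => //.
  by rewrite ler_wpM2l//; lra.
have := FTC1 (a := BLeft 0) (f := g) (fun y => ig _ (measurable_itv _) (muitv _ _ _ _)) lg.
apply: aeS2 gf => t gt H t0; by rewrite -gt//; apply: H; rewrite lte_fin.
Qed.

(* At a density point t of the zero set: if z (t + h) > e * |h|, then a ball of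
   radius proportional to |h| around t + h misses the zero set. *)
Lemma derivable_at_zeros (z : R -> R) (L : R) : lip L z -> (forall t, 0 <= z t) ->
  {ae mu, forall t : R, z t = 0 -> derivable z t 1 /\ derive1 z t = 0}.
Proof.
move=> lz z0; have L0 : 0 <= L.
  by have := lz 0 1 ler01; rewrite subr0 mulr1; apply: le_trans.
pose A := [set t : R | z t = 0].
have mA : measurable A.
  have mz : measurable_fun setT z := continuous_measurable_fun (lip_continuous lz).
  by have := mz measurableT [set (0:R)] (measurable_set1 0); rewrite setTI.
have := lebesgue_density mA; apply: aeS => t dt zt.
move: dt; rewrite indicE mem_set//= => dt.
apply/derivable_approxP => e e0.
(* [L1] exceeds both [e] and [L], so the radius [rho = e * |h| / L1] is below [|h|] and [z] varies
   by at most [e * |h|] within it. The constant [c] is then the share of a ball of radius [rho] in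
   one of radius [2 * |h|]. *)
pose L1 := L + e + 1; have L10 : 0 < L1 by rewrite /L1; lra.
pose c := e / (2 * L1).
have c0 : 0 < c by rewrite /c divr_gt0// mulr_gt0.
have [fin cv] := (fine_cvgP _ _).1 dt.
move/cvgrPdist_lt : cv => /(_ _ c0) cv.
have [r r0 Hr] : exists2 r : R, 0 < r & forall x, 0 < x < r ->
    (mu (A `&` ball t x) * (mu (ball t x))^-1)%E \is a fin_num /\
    `|1 - fine (mu (A `&` ball t x) * (mu (ball t x))^-1)%E| < c.
  have [r r0 H] := filterI fin cv; exists r => // x /andP[x0 xr].
  by apply: (H x) => //=; rewrite sub0r normrN gtr0_norm.
exists (r / 2) => [|h hr]; first by rewrite divr_gt0.
rewrite zt mul0r !subr0 ger0_norm// leNgt; apply/negP => zh.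
have h0 : 0 < `|h|.
  by rewrite normr_gt0; apply/eqP => h0; move: zh; rewrite h0 addr0 zt normr0 mulr0 ltxx.
have [|_] := Hr (2 * `|h|); first by apply/andP; split; lra.
pose rho := e * `|h| / L1.
have rho0 : 0 < rho by rewrite /rho divr_gt0// mulr_gt0.
have rhoh : rho < `|h|.
  rewrite /rho ltr_pdivrMr// mulrC ltr_pM2l// /L1; lra.
have rhoL : L * rho <= e * `|h|.
  rewrite /rho mulrA ler_pdivrMr//; have : L <= L1 by rewrite /L1; lra.
  have : 0 <= e * `|h| by rewrite mulr_ge0// ltW.
  by nra.
have disj : (A `&` ball t (2 * `|h|)) `&` ball (t + h) rho = set0.
  apply/seteqP; split=> y //= [[]]; rewrite /A /ball/= => zy _ hy.
  have := lip_dist y (t + h) lz; rewrite zy subr0 ger0_norm// => le1.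
  have : L * `|t + h - y| <= L * rho by rewrite ler_wpM2l// ltW.
  by lra.
have sub : (A `&` ball t (2 * `|h|)) `|` ball (t + h) rho `<=` ball t (2 * `|h|).
  move=> y [[]//|]; rewrite /ball/= => hy.
  have -> : t - y = (t + h - y) - h by ring.
  by apply: le_lt_trans (ler_normB _ _) _; lra.
have mB (x s : R) : measurable (ball x s) by exact: measurable_ball.
have mAB : measurable (A `&` ball t (2 * `|h|)) by exact: measurableI.
have : (mu ((A `&` ball t (2 * `|h|)) `|` ball (t + h)%R rho) <= mu (ball t (2 * `|h|)))%E.
  apply: le_measure; rewrite ?inE; [|exact: mB|exact: sub].
  by apply: measurableU; [exact: mAB|exact: mB].
have muB (x s : R) : 0 <= s -> mu (ball x s) = (s *+ 2)%:E by exact: lebesgue_measure_ball.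
rewrite (_ : mu (_ `|` _) = mu (A `&` ball t (2 * `|h|)) + mu (ball (t + h)%R rho))%E; last first.
  by apply: measureU; [exact: mAB|exact: mB|exact: disj].
rewrite muB ?(ltW rho0)// muB; last by lra.
have AB : (mu (A `&` ball t (2 * `|h|)) <= ((2 * `|h|) *+ 2)%:E)%E.
  by rewrite -(muB t); [apply: le_measure; rewrite ?inE; [exact: mAB|exact: mB|exact: subIsetr]|lra].
have ABfin : mu (A `&` ball t (2 * `|h|)) \is a fin_num.
  by rewrite ge0_fin_numE// (le_lt_trans AB)// ltry.
rewrite -(fineK ABfin); set a := fine _.
have hn : 2 * `|h| *+ 2 != 0 by rewrite mulrn_eq0/= gt_eqF//; lra.
rewrite inver (negbTE hn) -EFinM/= -EFinD lee_fin => le1.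
rewrite ltr_norml => /andP[_].
have -> : a * (2 * `|h| *+ 2)^-1 = a / (4 * `|h|).
  by congr (_ / _); rewrite -mulr_natr; ring.
have : a / (4 * `|h|) <= 1 - c.
  rewrite ler_pdivrMr; last by lra.
  have <- : 4 * `|h| - rho *+ 2 = (1 - c) * (4 * `|h|).
    by rewrite /c /rho -mulr_natr; field; rewrite gt_eqF.
  by lra.
by lra.
Qed.

End Primitive.

(** * The reflected net inflow solves the queue equation *)

Section QueueExists.
Variables (R : realType) (m : nat) (nu : 'I_m -> R) (f : 'I_m -> R -> R) (i : 'I_m).
Local Notation mu := (@lebesgue_measure R).

Lemma reflection_is_queue (F : R -> R) (u : R) : F 0 = 0 -> lip u F ->
  {ae mu, forall t : R, 0 < t -> derivable F t 1 /\ derive1 F t = f i t} ->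
  is_queue nu f i (reflection (fun t => F t - nu i * t)).
Proof.
move=> F0 lF dF; set X := (X in reflection X).
have lX : lip (u + `|nu i|) X by apply: lipD lF _; apply: lipN; exact: lip_linear.
have lz := lip_reflection lX.
have z0 t := reflection_ge0 lX t.
split; first exact: reflection0 lX.
split=> [b b0|]; first exact: lip_abs_cont lz.
apply: aeS2 dF (derivable_at_zeros lz z0) => t dF dz t0.
have [dFt F't] := dF t0.
have dX : forall e : R, 0 < e -> exists2 r : R, 0 < r &
   forall h, `|h| < r -> `|X (t + h) - X t - (f i t - nu i) * h| <= e * `|h|.
  move=> e e0; have [r r0 Hr] := (derivable_approxP F t _).1 (conj dFt F't) e e0.
  exists r => // h /Hr; rewrite /X.
  by have -> : F (t + h) - nu i * (t + h) - (F t - nu i * t) - (f i t - nu i) * h =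
    F (t + h) - F t - f i t * h by ring.
have := z0 t; rewrite le_eqVlt => /predU1P[/esym zt|zt].
  have [dzt z't] := dz zt; split=> //; right; split=> //.
  rewrite z't; apply/esym/max_idPr; rewrite leNgt; apply/negP => fnu.
  (* With this tolerance [X] rises by at least [3 * e * h] after [t], for [e] this quarter, while
     [z] rises by at most [e * h]; yet [z] grows at least as much as [X]. *)
  have e0 : 0 < (f i t - nu i) / 4 by rewrite divr_gt0.
  have [r1 r10 H1] := dX _ e0.
  have [r2 r20 H2] := (derivable_approxP _ t _).1 (conj dzt z't) _ e0.
  pose h := Num.min r1 r2 / 2.
  have h0 : 0 < h by rewrite /h divr_gt0// lt_min r10.
  have hr1 : `|h| < r1.
    rewrite gtr0_norm// /h; have : Num.min r1 r2 <= r1 by rewrite ge_min lexx.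
    by lra.
  have hr2 : `|h| < r2.
    rewrite gtr0_norm// /h; have : Num.min r1 r2 <= r2 by rewrite ge_min lexx orbT.
    by lra.
  have := H1 _ hr1; have := H2 _ hr2; rewrite zt [`|h|]gtr0_norm// !ler_norml.
  move=> /andP[_ k2] /andP[k1 _].
  have := @reflection_incr _ _ _ lX t (t + h).
  rewrite (ltW t0) lerDl (ltW h0) zt => /(_ isT) k3.
  have : 0 < (f i t - nu i) * h by rewrite mulr_gt0.
  by nra.
(* By continuity [z] stays positive around [t], so its increments on both sides are those of [X]. *)
suff [] : derivable (reflection X) t 1 /\ derive1 (reflection X) t = f i t - nu i.
  by move=> ? ->; split=> //; left.
apply/derivable_approxP => e e0; have [r1 r10 H1] := dX _ e0.
have [r2 r20 H2] := lip_near lz zt.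
exists (Num.min t (Num.min r1 r2)) => [|h]; first by rewrite !lt_min t0 r10.
rewrite !lt_min => /and3P[ht hr1 hr2].
have pos s : `|s - t| <= `|h| -> 0 < reflection X s.
  move=> hs; have := H2 t s (le_lt_trans hs hr2); rewrite ltr_norml => /andP[+ _].
  by lra.
have -> : reflection X (t + h) - reflection X t = X (t + h) - X t; last exact: H1.
have [h0|h0] := leP 0 h.
  apply: (reflection_busy lX) => [|s /andP[? ?]]; first by rewrite (ltW t0) lerDl.
  by apply: pos; rewrite (ger0_norm h0) ger0_norm; lra.
suff : reflection X t - reflection X (t + h) = X t - X (t + h) by lra.
apply: (reflection_busy lX) => [|s /andP[? ?]].
  by move: ht; rewrite ltr0_norm//; lra.
by apply: pos; rewrite (ltr0_norm h0) ler0_norm; lra.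
Qed.

End QueueExists.

(** * Equilibria and their rates of growth *)

Section FlowFacts.
Variable R : realType.
Local Notation mu := (@lebesgue_measure R).

Lemma ae_ex (P : R -> Prop) (a b : R) : {ae mu, forall t : R, P t} -> a < b ->
  exists2 t, a < t < b & P t.
Proof.
move=> [N [mN N0 HN]] ab; apply: contrapT => nex.
have sub : `]a, b[%classic `<=` N.
  move=> x; rewrite /= in_itv/= => hx; apply: HN => /= Px; apply: nex; by exists x.
have : (mu `]a, b[%classic <= mu N)%E.
  by apply: le_measure; rewrite ?inE; [exact: measurable_itv|exact: mN|exact: sub].
have -> : mu `]a, b[%classic = (b - a)%:E.
  by apply: etrans (lebesgue_measure_itv _) _; rewrite /= lte_fin ab.
by rewrite N0 lee_fin; lra.
Qed.

Lemma ae_forall_fin (m : nat) (P : 'I_m -> R -> Prop) :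
  (forall i, {ae mu, forall t : R, P i t}) -> {ae mu, forall t : R, forall i, P i t}.
Proof.
move=> H.
(* Indices are extended to all naturals, vacuously from [m] on, so that countable intersection
   applies. *)
have H' (n : nat) : {ae mu, forall t : R, forall h : (n < m)%N, P (Ordinal h) t}.
  have [h|/negP h] : (n < m)%N \/ ~~ (n < m)%N by apply/orP; case: (n < m)%N.
    2: by apply: aeW => t h'.
  by apply: aeS (H (Ordinal h)) => t Pt h'; rewrite (_ : Ordinal h' = Ordinal h)//; apply: val_inj.
by move/ae_foralln : H'; apply: aeS => t Ht [i hi]; exact: Ht.
Qed.

Variables (m : nat) (nu : 'I_m -> R) (u : R) (f : 'I_m -> R -> R).
Hypotheses (u0 : 0 < u) (ff : is_flow u f).

Lemma flow_le i : {ae mu, forall t : R, 0 <= t -> f i t <= u}.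
Proof.
have [_ [f0 fs]] := ff; apply: aeS fs => t ft t0.
rewrite -(ft t0) (bigD1 i)//= lerDl; apply: sumr_ge0 => j _; exact: f0.
Qed.

(** Without links the inflows would sum to 0 instead of [u > 0]. *)
Lemma flow_link : exists i : 'I_m, True.
Proof.
have [_ [_ fs]] := ff; have [t /andP[t0 _] ft] := ae_ex fs ltr01.
apply: contrapT => nex; have := ft (ltW t0); rewrite big1 => [E|i _].
  by move: u0; rewrite -E ltxx.
by exfalso; apply: nex; exists i.
Qed.

Lemma cumulative_inflow : exists F : 'I_m -> R -> R, forall i,
  [/\ F i 0 = 0, lip u (F i) &
    {ae mu, forall t : R, 0 < t -> derivable (F i) t 1 /\ derive1 (F i) t = f i t}].
Proof.
have [mf [f0 _]] := ff.
have H i := primitive_exists (mf i) (f0 i) (ltW u0) (flow_le i).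
by exists (fun i => projT1 (cid (H i))) => i; exact: projT2 (cid (H i)).
Qed.

Section WithInflow.
Variable F : 'I_m -> R -> R.
Hypothesis HF : forall i, [/\ F i 0 = 0, lip u (F i) &
    {ae mu, forall t : R, 0 < t -> derivable (F i) t 1 /\ derive1 (F i) t = f i t}].

Definition workload (i : 'I_m) : R -> R := reflection (fun t => F i t - nu i * t).

Lemma lip_netflow i : lip (u + `|nu i|) (fun t => F i t - nu i * t).
Proof.
have [_ lF _] := HF i.
by apply: lipD lF _; apply: lipN; exact: lip_linear.
Qed.

(* [queue] is chosen by [xget], so this needs both existence and uniqueness. *)
Lemma queueE i t : 0 <= t -> queue nu f i t = workload i t.
Proof.
have [F0 lF dF] := HF i; have qz := reflection_is_queue nu F0 lF dF.
have qq : is_queue nu f i (queue nu f i).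
  exact: (@xgetPex _ (fun=> 0) [set z | is_queue nu f i z] (ex_intro _ _ qz)).
exact: is_queue_unique qq qz t.
Qed.

Lemma inflow_le i s t : 0 <= s <= t -> F i s <= F i t.
Proof.
move=> /andP[s0 st]; have [_ lF dF] := HF i; have [_ [f0 _]] := ff.
rewrite -lerN2; apply: (@abs_cont_nonincr _ s t (- F i)) => //.
  exact: lip_abs_cont (lipN lF).
apply: aeS dF => r dr /andP[sr rt]; have [] := dr (le_lt_trans s0 sr) => d1 d2.
split; first exact: derivableN.
by rewrite derive1E deriveN// -derive1E d2 oppr_le0 f0// (le_trans s0)// ltW.
Qed.

Lemma inflow_idle i s t : 0 <= s <= t ->
  {ae mu, forall r : R, s < r < t -> ~ 0 < f i r} -> F i t = F i s.
Proof.
move=> /andP[s0 st] idle; have [_ lF dF] := HF i; have [_ [f0 _]] := ff.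
apply/eqP; rewrite eq_le (@inflow_le i s t) ?s0// andbT.
apply: abs_cont_nonincr => //; first exact: lip_abs_cont lF.
apply: aeS2 dF idle => r dr ir /andP[sr rt]; have [] := dr (le_lt_trans s0 sr) => d1 ->.
by split=> //; rewrite leNgt; apply/negP; apply: ir; rewrite sr.
Qed.

(** The difference [G] of the two sides, as a function of time, has derivative 0 almost everywhere;
    monotonicity applied to [G] and [- G] makes it constant. *)
Lemma inflow_total s t : 0 <= s <= t -> \sum_i (F i t - F i s) = u * (t - s).
Proof.
move=> /andP[s0 st]; have [_ [f0 fs]] := ff.
pose G : R -> R := (\sum_(i < m) F i) - (fun r => u * r).
have lG : exists K, lip K G.
  have lS : lip (\sum_(i < m) u) (\sum_(i < m) F i).
    move=> r r' rr'; rewrite !fct_sumE -sumrB mulr_suml.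
    apply: le_trans (ler_norm_sum _ _ _) _; apply: ler_sum => i _.
    by have [_ lF _] := HF i; exact: lF.
  by exists (\sum_(i < m) u + `|u|); apply: lipD lS _; apply: lipN; exact: lip_linear.
have [K lK] := lG.
have dF : {ae mu, forall r : R, forall i, 0 < r -> derivable (F i) r 1 /\ derive1 (F i) r = f i r}.
  by apply: ae_forall_fin => i; have [] := HF i.
have dG : {ae mu, forall r : R, s < r < t -> derivable G r 1 /\ derive1 G r = 0}.
  apply: aeS2 dF fs => r dr fr /andP[sr rt]; have r0 := le_lt_trans s0 sr.
  have dS : derivable (\sum_(i < m) F i) r 1.
    by apply: derivable_sum => i; have [] := dr i r0.
  have [dl dl'] : derivable (fun r : R => u * r) r 1 /\ derive1 (fun r : R => u * r) r = u.
    apply/derivable_approxP => e e0; exists 1 => // h _.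
    have -> : u * (r + h) - u * r - u * h = 0 by ring.
    by rewrite normr0 mulr_ge0// ltW.
  split; first exact: derivableB.
  rewrite derive1E in dl'; rewrite derive1E deriveB// dl' derive_sum; last first.
    by move=> i; have [] := dr i r0.
  rewrite (eq_bigr (fun i => f i r)); last first.
    by move=> i _; rewrite -derive1E; have [] := dr i r0.
  by rewrite fr ?subrr// ltW.
have E : G t = G s.
  apply/eqP; rewrite eq_le; apply/andP; split.
    apply: abs_cont_nonincr => //; first exact: lip_abs_cont lK.
    by apply: aeS dG => r dr /dr [? ->].
  rewrite -lerN2; apply: (@abs_cont_nonincr _ s t (- G)) => //.
    exact: lip_abs_cont (lipN lK).
  apply: aeS dG => r dr /dr [d d']; split; first exact: derivableN.
  by rewrite derive1E deriveN// -derive1E d' oppr0.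
move: E; rewrite /G !fctE !fct_sumE => E.
by rewrite sumrB mulrBr; lra.
Qed.

End WithInflow.
End FlowFacts.

(** * The state of an equilibrium in terms of its exit time *)

Section Profile.
Variables (R : realType) (m : nat).
Local Notation mu := (@lebesgue_measure R).

(* E is the earliest perceived exit time over all links and F the cumulative
   inflow; E t - t is the perceived delay on which the whole state depends. *)
Record equilibrium_profile (nu : 'I_m -> R) (u : R) (tau : 'I_m -> R)
    (f F : 'I_m -> R -> R) (E : R -> R) : Prop := EquilibriumProfile {
  profile_lip : exists K, lip K E;
  profile_mono : forall s t, 0 <= s <= t -> E s <= E t;
  profile_queue : forall i t, 0 <= t ->
    queue nu f i t = nu i * Num.max (E t - t - tau i) 0;
  profile_incr : forall i s t, 0 <= s <= t ->
    F i t - F i s - nu i * (t - s) <= queue nu f i t - queue nu f i s;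
  profile_busy : forall i s t, 0 <= s <= t ->
    (forall r, s < r <= t -> tau i < E r - r) ->
    F i t - F i s - nu i * (t - s) = queue nu f i t - queue nu f i s;
  profile_inflow_le : forall i s t, 0 <= s <= t -> F i s <= F i t;
  profile_idle : forall i s t, 0 <= s <= t ->
    {ae mu, forall r : R, s < r < t -> ~ 0 < f i r} -> F i t = F i s;
  profile_total : forall s t, 0 <= s <= t -> \sum_i (F i t - F i s) = u * (t - s);
  profile_used : {ae mu, forall t : R, 0 <= t -> forall i, 0 < f i t -> tau i <= E t - t};
  profile_start : exists2 i, E 0 = tau i & forall j, tau i <= tau j }.

(** [E] is the pointwise minimum of the link exit times [Ei]. The crux is [profile_queue]: a link
    with a positive queue attains the minimum even when nobody is entering it. *)
Lemma equilibrium_has_profile (nu : 'I_m -> R) (u : R) (tau : 'I_m -> R)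
    (f : 'I_m -> R -> R) : (forall i, 0 < nu i) -> 0 < u ->
  is_equilibrium nu u tau f -> exists F E, equilibrium_profile nu u tau f F E.
Proof.
move=> nu0 u0 [ff eqf]; have [i0 _] := flow_link u0 ff.
have [F HF] := cumulative_inflow u0 ff.
pose z := workload nu F; pose Ei i t := t + z i t / nu i + tau i.
have zE i t : 0 <= t -> queue nu f i t = z i t by exact: queueE.
have lX i := lip_netflow nu HF i.
have z0 i t : 0 <= z i t := reflection_ge0 (lX i) t.
have lz i : lip (u + `|nu i|) (z i) := lip_reflection (lX i).
have lEi i : exists2 K, 0 <= K & lip K (Ei i).
  have K0 : 0 <= (u + `|nu i|) / nu i by apply: divr_ge0; [apply: addr_ge0; [exact: ltW|]|exact: ltW].
  exists (1 + (u + `|nu i|) / nu i) => [|s t st]; first by rewrite addr_ge0.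
  have -> : Ei i t - Ei i s = (t - s) + (z i t - z i s) / nu i.
    by rewrite /Ei; field; rewrite gt_eqF.
  apply: le_trans (ler_normD _ _) _; rewrite [`|t - s|]ger0_norm ?subr_ge0//.
  rewrite [(1 + _) * _]mulrDl mul1r lerD2l.
  rewrite normrM normfV (gtr0_norm (nu0 i)) mulrAC ler_pM2r ?invr_gt0//.
  by have := lz i s t st; rewrite (gtr0_norm (nu0 i)).
pose E t := Ei [arg min_(j < i0) Ei j t]%O t.
have E_le j t : E t <= Ei j t.
  by rewrite /E; case: Order.TotalTheory.arg_minP => // i _; apply.
have E_att t : exists j, E t = Ei j t by eexists; reflexivity.
have lE : exists K, lip K E.
  pose Kf i := projT1 (cid2 (lEi i)).
  have Kf0 i : 0 <= Kf i by rewrite /Kf; case: cid2.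
  have lKf i : lip (Kf i) (Ei i) by rewrite /Kf; case: cid2.
  exists (\sum_i Kf i) => s t st.
  have lK i : `|Ei i t - Ei i s| <= (\sum_i Kf i) * (t - s).
    apply: le_trans (lKf i _ _ st) _; rewrite ler_wpM2r ?subr_ge0//.
    by rewrite (bigD1 i)//= lerDl sumr_ge0.
  have [i Ei1] := E_att s; have [j Ej] := E_att t.
  have h1 := E_le i t; have h2 := E_le j s.
  have := lK i; have := lK j; rewrite !ler_norml => /andP[? ?] /andP[? ?].
  by apply/andP; split; lra.
(* A queue drains at rate at most [nu i], so its waiting time falls no faster than time passes. *)
have monoEi i s t : 0 <= s <= t -> Ei i s <= Ei i t.
  move=> st; have Fle := inflow_le ff HF i st.
  have h : F i t - nu i * t - (F i s - nu i * s) <= z i t - z i s := reflection_incr (lX i) st.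
  have : - nu i * (t - s) <= z i t - z i s by lra.
  move=> h'; rewrite -(ler_pM2r (nu0 i)) /Ei.
  have e1 x y : (x + z i y / nu i + tau i) * nu i = x * nu i + z i y + tau i * nu i.
    by field; rewrite gt_eqF.
  by rewrite !e1; lra.
have monoE s t : 0 <= s <= t -> E s <= E t.
  move=> st; have [j ->] := E_att t.
  by apply: le_trans (E_le j s) _; exact: monoEi.
have used : {ae mu, forall t : R, 0 <= t -> forall i, 0 < f i t -> E t = Ei i t}.
  apply: aeS eqf => t eft t0 i fi; have [j Ej] := E_att t.
  apply/eqP; rewrite eq_le E_le Ej -lee_fin.
  have := eft t0 i fi; rewrite /exit_time zE// -/(Ei i t) => ->.
  by apply: le_trans (bigmin_le _ j _) _; rewrite /exit_time zE.
have zmax i t : 0 <= t -> z i t = nu i * Num.max (E t - t - tau i) 0.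
  move=> t0; have := z0 i t; rewrite le_eqVlt => /predU1P[zt|zt].
    have := E_le i t; rewrite /Ei -zt mul0r => ?.
    by rewrite max_r ?mulr0//; lra.
  suff -> : E t = Ei i t.
    rewrite max_l /Ei; last first.
      rewrite (_ : _ - _ - _ = z i t / nu i); last by ring.
      by apply: divr_ge0; [exact: z0|exact: ltW].
    by field; rewrite gt_eqF.
  apply/eqP; rewrite eq_le E_le /= leNgt; apply/negP => lt.
  have [K lK] := lE; have [Ki _ lKi] := lEi i.
  have lD : lip (Ki + K) (fun s => Ei i s - E s) := lipD lKi (lipN lK).
  (* After [s0] link [i] is busy but not optimal, so nothing enters it and [Ei i] stays constant,
     while [E] can only have grown. Hence [i] was already busy and not optimal at [s0], a
     contradiction. *)
  have [||||s0 /andP[s00 s0t] [nP HP]] :=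
    last_exit (a := 0) (t := t) (P := fun s => 0 < z i s /\ E s < Ei i s).
  - by [].
  - by rewrite /z /workload (reflection0 (lX i)) ltxx => -[].
  - by split.
  - move=> s hs [zs Es].
    have [r1 r10 H1] := lip_near (lz i) zs.
    have Ds : 0 < Ei i s - E s by lra.
    have [r2 r20 H2] := lip_near lD Ds.
    exists (Num.min r1 r2) => [|s' _]; first by rewrite lt_min r10.
    rewrite lt_min => /andP[/H1 + /H2]; rewrite !ltr_norml => /andP[? _] /andP[? _].
    by split; lra.
  have s0t' : 0 <= s0 <= t by rewrite s00 ltW.
  have Fi : F i t = F i s0.
    apply: (inflow_idle ff HF) => //.
    apply: aeS used => r ur /andP[s0r rt] fr.
    have [] := HP r; first by rewrite s0r ltW.
    by rewrite (ur _ _ fr) ?ltxx// ltW// (le_lt_trans s00).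
  have : z i t - z i s0 = F i t - nu i * t - (F i s0 - nu i * s0) :=
    reflection_busy (lX i) s0t' (fun r hr => proj1 (HP r hr)).
  rewrite Fi => zz.
  have EE : Ei i t = Ei i s0.
    rewrite /Ei (_ : z i t = z i s0 - nu i * (t - s0)); last by lra.
    by field; rewrite gt_eqF.
  apply: nP; split.
    have : 0 < nu i * (t - s0) by rewrite mulr_gt0// subr_gt0.
    by lra.
  by rewrite -EE; apply: le_lt_trans (monoE _ _ s0t') _.
exists F, E; split => //.
- by move=> i t t0; rewrite zE// zmax.
- move=> i s t /andP[s0 st]; rewrite !zE ?(le_trans s0 st)//.
  have st' : 0 <= s <= t by rewrite s0.
  have : F i t - nu i * t - (F i s - nu i * s) <= z i t - z i s := reflection_incr (lX i) st'.
  by lra.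
- move=> i s t /andP[s0 st] H; rewrite !zE ?(le_trans s0 st)//.
  suff : z i t - z i s = F i t - nu i * t - (F i s - nu i * s) by move=> ->; ring.
  apply: (reflection_busy (lX i)); first by rewrite s0.
  move=> r /andP[sr rt]; have r0 : 0 <= r by rewrite (le_trans s0) ?ltW.
  change (0 < z i r); rewrite zmax// mulr_gt0// lt_max; apply/orP; left.
  by rewrite subr_gt0 H ?sr.
- by move=> i s t; exact: (inflow_le ff HF).
- by move=> i s t; exact: (inflow_idle ff HF).
- by move=> s t; exact: (inflow_total ff HF).
- apply: aeS used => t ut t0 i /(ut t0 i) ->.
  have : 0 <= z i t / nu i by rewrite divr_ge0// ltW.
  by rewrite /Ei; lra.
- have Ei0 i : Ei i 0 = tau i.
    by rewrite /Ei /z /workload (reflection0 (lX i)) mul0r !add0r.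
  have [j Ej] := E_att 0; exists j => [|i]; first by rewrite Ej Ei0.
  by rewrite -Ei0 -Ej -(Ei0 i).
Qed.

End Profile.

(** * Growth rate of the delay *)

Section Rates.
Variables (R : realType) (m : nat) (nu : 'I_m -> R) (u : R) (tau : 'I_m -> R).
Variables (f F : 'I_m -> R -> R) (E : R -> R).
Local Notation mu := (@lebesgue_measure R).
Hypotheses (nu0 : forall i, 0 < nu i) (u0 : 0 < u).
Hypothesis prof : equilibrium_profile nu u tau f F E.

Definition capacity (A : pred 'I_m) : R := \sum_(i | A i) nu i.

Lemma capacity_le (A B : pred 'I_m) : (forall i, A i -> B i) -> capacity A <= capacity B.
Proof.
move=> AB; rewrite /capacity [leLHS]big_mkcond [leRHS]big_mkcond; apply: ler_sum => i _.
by case: ifP => [/AB ->//|_]; case: ifP => // _; exact: ltW.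
Qed.

Lemma capacity_ge0 (A : pred 'I_m) : 0 <= capacity A.
Proof. by apply: sumr_ge0 => i _; exact: ltW. Qed.

(** Links of [A] are busy throughout, so each queue changes by [nu i] times the change of the delay,
    and together they receive at most [u * (t - s)]. *)
Lemma waiting_rate_le (A : pred 'I_m) s t : 0 <= s <= t ->
  (forall i, A i -> forall r, s <= r <= t -> tau i < E r - r) ->
  capacity A * ((E t - t) - (E s - s)) <= (u - capacity A) * (t - s).
Proof.
move=> /andP[s0 st] HA; have st0 : 0 <= s <= t by rewrite s0.
have t0 : 0 <= t := le_trans s0 st.
have -> : capacity A * ((E t - t) - (E s - s)) =
    \sum_(i | A i) (F i t - F i s - nu i * (t - s)).
  rewrite /capacity mulr_suml; apply: eq_bigr => i Ai.
  rewrite (profile_busy prof (i := i) st0); last first.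
    by move=> r /andP[sr rt]; apply: HA => //; rewrite ltW.
  rewrite !(profile_queue prof)// !max_l; first by ring.
    by have := HA _ Ai s; rewrite lexx st => /(_ isT); lra.
  by have := HA _ Ai t; rewrite lexx st => /(_ isT); lra.
rewrite sumrB -mulr_suml -/(capacity A) mulrBl lerD2r -(profile_total prof st0).
rewrite [leLHS]big_mkcond; apply: ler_sum => i _; case: ifP => // _.
by rewrite subr_ge0 (profile_inflow_le prof).
Qed.

(** All inflow enters [B], whose queues gain at least the surplus over capacity. Each gains at most
    [nu i] times the growth of the delay; if the delay fell, no queue would grow. *)
Lemma waiting_rate_ge (B : pred 'I_m) s t : 0 <= s <= t ->
  {ae mu, forall r : R, s < r < t -> forall i, 0 < f i r -> B i} ->
  capacity B < u ->
  (u - capacity B) * (t - s) <= capacity B * ((E t - t) - (E s - s)).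
Proof.
move=> /andP[s0 st] HB Bu; have st0 : 0 <= s <= t by rewrite s0.
have t0 : 0 <= t := le_trans s0 st.
have le1 : (u - capacity B) * (t - s) <=
    \sum_(i | B i) (queue nu f i t - queue nu f i s).
  have -> : (u - capacity B) * (t - s) =
      \sum_(i | B i) (F i t - F i s - nu i * (t - s)).
    rewrite sumrB -mulr_suml -/(capacity B) mulrBl -(profile_total prof st0).
    congr (_ - _); rewrite [RHS]big_mkcond; apply: eq_bigr => i _.
    case: ifP => // /negP nB; rewrite (profile_idle prof st0) ?subrr//.
    by apply: aeS HB => r Hr /Hr {}Hr /Hr.
  by apply: ler_sum => i _; exact: (profile_incr prof).
have [cst|ctt] := leP (E s - s) (E t - t).
  apply: le_trans le1 _; rewrite /capacity mulr_suml; apply: ler_sum => i _.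
  rewrite !(profile_queue prof)// -mulrBr ler_pM2l//.
  rewrite lerBlDr ge_max; apply/andP; split.
    have : E s - s - tau i <= Num.max (E s - s - tau i) 0 by rewrite le_max lexx.
    by lra.
  have : 0 <= Num.max (E s - s - tau i) 0 by rewrite le_max lexx orbT.
  by lra.
have : \sum_(i | B i) (queue nu f i t - queue nu f i s) <= 0.
  rewrite sumr_le0// => i _; rewrite subr_le0 !(profile_queue prof)// ler_pM2l//.
  by rewrite ge_max !le_max lexx orbT andbT; apply/orP; left; lra.
move=> le2; have : (u - capacity B) * (t - s) <= 0 by lra.
rewrite pmulr_rle0 ?subr_gt0// subr_le0 => ts.
have E1 : t = s by apply/le_anti; rewrite ts.
by move: ctt; rewrite E1 ltxx.
Qed.

Lemma lip_waiting : exists K, lip K (fun t => E t - t).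
Proof.
have [K lK] := profile_lip prof; exists (K + 1); apply: lipD lK _; apply: lipN.
by move=> s t st; rewrite mul1r ger0_norm// subr_ge0.
Qed.

(** Let [i1] have the largest [tau] in the set. Since the delay last exceeded [tau i1], all links of
    the set have been busy; with capacity at least [u] the delay could not have grown. *)
Lemma waiting_capacity t : 0 <= t -> capacity [pred i | tau i < E t - t] < u.
Proof.
move=> t0; rewrite ltNge; apply/negP; set A := (A in capacity A) => uA'.
have uA : u <= capacity A by [].
have [i0 Ai0] : exists i, A i.
  apply: contrapT => nex; move: uA; rewrite /capacity big1; first by rewrite leNgt u0.
  by move=> i Ai; exfalso; apply: nex; exists i.
have [i1 Ai1 Hi1] := Order.TotalTheory.arg_maxP tau Ai0.
have [K lK] := lip_waiting.
have [||||s0 /andP[s00 s0t] [nP HP]] :=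
    last_exit (a := 0) (t := t) (P := fun s => tau i1 < E s - s) => //.
- have [j -> jmin] := profile_start prof; rewrite subr0.
  by apply/negP; rewrite -leNgt.
- move=> s _ Ps; have es : 0 < E s - s - tau i1 by lra.
  have [r r0 Hr] := lip_near lK es; exists r => // s' _ /Hr.
  by rewrite ltr_norml => /andP[? _]; lra.
have {}nP : E s0 - s0 <= tau i1 by rewrite leNgt; exact/negP.
have {}Ai1 : tau i1 < E t - t by [].
have e0 : 0 < E t - t - tau i1 by lra.
have [r r0 Hr] := lip_near lK e0.
(* The strict inequality fails at [s0], so the rate bound is applied from a slightly later [s],
   where by continuity the delay is still below its value at [t]. *)
have [s /andP[s0s sm]] : exists s, s0 < s < Num.min t (s0 + r).
  exists ((s0 + Num.min t (s0 + r)) / 2).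
  have : s0 < Num.min t (s0 + r) by rewrite lt_min s0t; lra.
  by move=> ?; apply/andP; split; lra.
have [st sr] : s < t /\ s < s0 + r by apply/andP; rewrite -lt_min.
have s_0 : 0 <= s by lra.
have := @waiting_rate_le A s t; rewrite s_0 ltW// => /(_ isT).
have HA i : A i -> forall x, s <= x <= t -> tau i < E x - x.
  move=> Ai x /andP[sx xt]; apply: le_lt_trans (Hi1 i Ai) _.
  by apply: HP; rewrite xt (lt_le_trans s0s).
move=> /(_ HA) rate; clear HA.
have : (u - capacity A) * (t - s) <= 0 by rewrite mulr_le0_ge0//; lra.
have := Hr s0 s; rewrite [`|s - s0|]ger0_norm; last by lra.
have -> : s - s0 < r by lra.
move=> /(_ isT); rewrite ltr_norml => /andP[_ cs].
have A0 : 0 < capacity A := lt_le_trans u0 uA.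
have : 0 < capacity A * (E t - t - (E s - s)).
  by apply: mulr_gt0 => //; move: cs nP => /=; lra.
by lra.
Qed.

(** While link [i] is busy but nobody enters it, its exit time [E] stands still. The bound [M],
    valid for those who enter, therefore persists until [T]. *)
Lemma last_use_le (tau0 : 'I_m -> R) (T M : R) i : 0 <= T ->
  {ae mu, forall t : R, 0 <= t <= T -> forall i, 0 < f i t -> E t - tau i + tau0 i <= M} ->
  tau i < E T - T -> E T - tau i + tau0 i <= M.
Proof.
move=> T0 HM ciT; rewrite leNgt; apply/negP => lt.
(* [e < E s] says that a particle entering link [i] at [s], with perceived exit [E s], leaves after
   [M] in terms of [tau0]. *)
pose e := M + tau i - tau0 i.
have [K lK] := profile_lip prof; have [Kc lKc] := lip_waiting.
have [||||s0 /andP[s00 s0t] [nP HP]] :=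
    last_exit (a := 0) (t := T) (P := fun s => e < E s /\ tau i < E s - s) => //.
- have [j -> jmin] := profile_start prof; rewrite subr0 => -[_].
  by apply/negP; rewrite -leNgt.
- by split=> //; rewrite /e; lra.
- move=> s _ [Ps1 Ps2]; have e1 : 0 < E s - e by lra.
  have e2 : 0 < E s - s - tau i by lra.
  have [r1 r10 H1] := lip_near lK e1; have [r2 r20 H2] := lip_near lKc e2.
  exists (Num.min r1 r2) => [|s' _]; first by rewrite lt_min r10.
  rewrite lt_min => /andP[/H1 + /H2]; rewrite !ltr_norml => /andP[? _] /andP[? _].
  by split; lra.
have st : 0 <= s0 <= T by rewrite s00 ltW.
have FE : F i T = F i s0.
  apply: (profile_idle prof) => //; apply: aeS HM => r Hr /andP[s0r rT] fr.
  have [] := HP r; first by rewrite s0r ltW.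
  have := Hr _ i fr; rewrite (ltW rT) (le_trans s00 (ltW s0r)) => /(_ isT).
  by rewrite /e; lra.
have busy r : s0 < r <= T -> tau i < E r - r by move=> /HP[].
have := profile_busy prof st busy.
rewrite FE !(profile_queue prof)// max_l; last by lra.
move=> qE; have {qE} : E T - T - tau i = Num.max (E s0 - s0 - tau i) 0 - (T - s0).
  by apply: (mulfI (lt0r_neq0 (nu0 i))); rewrite mulrBr; lra.
have [h1|h1] := leP (E s0 - s0 - tau i) 0; first by lra.
by move=> h2; apply: nP; rewrite /e; split; lra.
Qed.

End Rates.

(** * Comparison of two equilibria backwards in time *)

Section Comparison.
Variables (R : realType) (m : nat) (nu : 'I_m -> R) (u : R).
Variables (tau tau' : 'I_m -> R) (f F f' F' : 'I_m -> R -> R) (E E' : R -> R).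
Local Notation mu := (@lebesgue_measure R).
Hypotheses (nu0 : forall i, 0 < nu i) (u0 : 0 < u).
Hypothesis prof : equilibrium_profile nu u tau f F E.
Hypothesis prof' : equilibrium_profile nu u tau' f' F' E'.

(* Links used by f' near t satisfy tau i < a, where a is slightly below the
   delay E t - t of f.  So near t the delay of f grows at rate at most
   u / capacity - 1, that of f' at rate at least that, for the same set of links. *)
Lemma gap_local_step (t d eta : R) : 0 < t -> d < E t - E' t -> 0 < eta ->
  {ae mu, forall r : R, 0 <= r -> t - eta < r < t ->
     forall i, 0 < f' i r -> tau i <= tau' i + d} ->
  exists2 rho : R, 0 < rho & forall s, 0 <= s -> t - rho < s < t ->
    E' s - s < E' t - t /\ E t - E' t <= E s - E' s.
Proof.
move=> t0 dgap eta0 Hd.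
pose e := (E t - E' t - d) / 2; pose a := E t - t - e.
have e0 : 0 < e by rewrite /e; lra.
have [K lK] := lip_waiting prof; have [K' lK'] := lip_waiting prof'.
have [r1 r10 H1] := lip_near lK e0; have [r2 r20 H2] := lip_near lK' e0.
exists (Num.min eta (Num.min r1 r2)) => [|s s0 /andP[ts st]].
  by rewrite !lt_min eta0 r10.
have [teta tr1 tr2] : [/\ t - s < eta, t - s < r1 & t - s < r2].
  by apply/and3P; rewrite -!lt_min; lra.
have near1 r : s <= r <= t -> a < E r - r.
  move=> /andP[sr rt]; have := H1 t r; rewrite distrC [`|t - r|]ger0_norm; last by lra.
  have -> : t - r < r1 by lra.
  by move=> /(_ isT); rewrite ltr_norml /= /a => /andP[? _]; lra.
have near2 r : s <= r <= t -> E' r - r < E' t - t + e.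
  move=> /andP[sr rt]; have := H2 t r; rewrite distrC [`|t - r|]ger0_norm; last by lra.
  have -> : t - r < r2 by lra.
  by move=> /(_ isT); rewrite ltr_norml /= => /andP[_ ?]; lra.
pose A : pred 'I_m := fun i => tau i < a.
have Au : capacity nu A < u.
  apply: (le_lt_trans _ (waiting_capacity u0 prof (ltW t0))); apply: capacity_le => // i.
  by rewrite /A /= /a; lra.
have st' : 0 <= s <= t by rewrite s0 ltW.
have up : capacity nu A * ((E t - t) - (E s - s)) <= (u - capacity nu A) * (t - s).
  by apply: (waiting_rate_le prof) => // i Ai r /near1; apply: lt_trans.
have lo : (u - capacity nu A) * (t - s) <= capacity nu A * ((E' t - t) - (E' s - s)).
  apply: (waiting_rate_ge nu0 prof') => //.
  apply: aeS2 Hd (profile_used prof') => r Hr ur /andP[sr rt] i fi.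
  have r0 : 0 <= r by lra.
  have k1 := ur r0 i fi.
  have k2 : tau i <= tau' i + d by apply: Hr fi => //; apply/andP; split; lra.
  have k3 : E' r - r < E' t - t + e by apply: near2; apply/andP; split; lra.
  (* The chain is [tau i <= tau' i + d <= E' r - r + d < E' t - t + e + d = a]; the last equality is
     why [e] is half of the excess of the gap over [d]. *)
  by rewrite /A /a /e; move: k1 k2 k3; rewrite /e; lra.
have pos : 0 < (u - capacity nu A) * (t - s) by rewrite mulr_gt0// subr_gt0.
have A0 : 0 < capacity nu A.
  rewrite lt_neqAle capacity_ge0// andbT; apply/eqP => A0.
  by move: lo; rewrite -A0 mul0r => ?; move: pos; rewrite -A0; lra.
split.
  have : 0 < capacity nu A * ((E' t - t) - (E' s - s)) by lra.
  by rewrite pmulr_rgt0//; lra.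
have : capacity nu A * ((E t - t) - (E s - s)) <= capacity nu A * ((E' t - t) - (E' s - s)).
  by lra.
by rewrite ler_pM2l//; lra.
Qed.

(** A first step back from [T] makes the delay of [f'] strictly smaller than its final value. From
    then on [used_le] covers every link used by [f'], and real induction in reversed time reaches
    0. *)
Lemma makespan_lower_bound (T M : R) : 0 < T ->
  {ae mu, forall t : R, 0 <= t <= T -> forall i, 0 < f' i t -> E' t - tau' i + tau i <= M} ->
  E T <= M.
Proof.
move=> T0 HM; rewrite leNgt; apply/negP => MT.
pose d := M - E' T; pose d' := (d + (E T - E' T)) / 2.
have dT : d < E T - E' T by rewrite /d; lra.
have used_le i : tau' i < E' T - T -> tau i <= tau' i + d.
  by move=> /(last_use_le nu0 prof' (ltW T0) HM); rewrite /d; lra.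
have [K lK] := profile_lip prof; have [K' lK'] := profile_lip prof'.
have [Kw' lKw'] := lip_waiting prof'.
have [rho rho0 Hrho] : exists2 rho : R, 0 < rho & forall s, 0 <= s -> T - rho < s < T ->
    E' s - s < E' T - T /\ E T - E' T <= E s - E' s.
  have dd' : 0 < d' - d by rewrite /d'; lra.
  have [eta eta0 Heta] := lip_near lK' dd'.
  (* Near [T] a link in use may have [tau' i] at or above the final delay, outside the reach of
     [used_le]. There the bound [M] is used directly, and [d' - d] absorbs the variation of [E']. *)
  apply: (@gap_local_step T d' eta) => //; first by rewrite /d'; lra.
  apply: aeS HM => r Hr r0 /andP[Tr rT] i fi.
  have := Hr _ i fi; rewrite r0 ltW// => /(_ isT).
  have := Heta T r; rewrite distrC [`|T - r|]ger0_norm; last by lra.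
  have -> : T - r < eta by lra.
  by move=> /(_ isT); rewrite ltr_norml /d => /andP[? _]; lra.
pose s1 := Num.max 0 (T - rho / 2).
have s10 : 0 <= s1 by rewrite /s1 le_max lexx.
have s1T : s1 < T by rewrite /s1 gt_max T0; lra.
have s1rho : T - rho < s1.
  have : T - rho / 2 <= s1 by rewrite /s1 le_max lexx orbT.
  by lra.
have [c1 g1] : E' s1 - s1 < E' T - T /\ E T - E' T <= E s1 - E' s1.
  by apply: Hrho => //; rewrite s1rho.
pose P r := E' r - r <= E' s1 - s1 /\ E T - E' T <= E r - E' r.
have lG : lip (K + K') (fun r => E r - E' r) := lipD lK (lipN lK').
have P0 : P 0.
  (* Time is reversed by [x = s1 - r]; the limit case below holds because both parts of [P] are
     closed conditions. *)
  have := @real_induction R 0 s1 (fun x => P (s1 - x)).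
  move=> /(_ _ _ _ s1); rewrite subrr; apply; last by rewrite s10 lexx.
  - by rewrite subr0; split.
  - move=> x /andP[x0 xs1] [Px1 Px2]; set t := s1 - x in Px1 Px2.
    have t0 : 0 < t by rewrite /t; lra.
    have ct : 0 < E' T - T - (E' t - t) by lra.
    have [eta eta0 Heta] := lip_near lKw' ct.
    have [||||rho' rho'0 H] := @gap_local_step t d eta => //; first by lra.
      apply: aeS (profile_used prof') => r ur r0 /andP[tr rt] i fi.
      apply: used_le; have := ur r0 i fi.
      have := Heta t r; rewrite distrC [`|t - r|]ger0_norm; last by lra.
      have -> : t - r < eta by lra.
      by move=> /(_ isT); rewrite ltr_norml /= => /andP[_ ?]; lra.
    exists rho' => // y /andP[xy yr] ys1.
    have [||h1 h2] := H (s1 - y); first by lra.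
      by rewrite /t; apply/andP; split; lra.
    by split; lra.
  - move=> x /andP[x0 xs1] HP; set t := s1 - x.
    have close e (g : R -> R) Kg : lip Kg g -> 0 < e -> exists2 y, 0 <= y < x &
        `|g (s1 - y) - g t| < e.
      move=> lg e0; have [r r0 Hr] := lip_near lg e0.
      pose y := Num.max 0 (x - r / 2).
      have y0 : 0 <= y by rewrite /y le_max lexx.
      have yx : y < x by rewrite /y gt_max x0; lra.
      have xy : x - r / 2 <= y by rewrite /y le_max lexx orbT.
      exists y; first by rewrite y0.
      by apply: Hr; rewrite /t ltr_norml; apply/andP; split; lra.
    split; rewrite leNgt; apply/negP => lt.
      have e0 : 0 < E' t - t - (E' s1 - s1) by lra.
      have [y hy] := close _ _ _ lKw' e0; have [k1 _] := HP y hy.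
      by rewrite ltr_norml /= => /andP[? _]; lra.
    have e0 : 0 < E T - E' T - (E t - E' t) by lra.
    have [y hy] := close _ _ _ lG e0; have [_ k2] := HP y hy.
    by rewrite ltr_norml /= => /andP[_ ?]; lra.
have [P01 P02] := P0.
have [i E'0 _] := profile_start prof'; have [j E0 jmin] := profile_start prof.
have := used_le i; have := jmin i; rewrite -E'0 -E0 => k1 k2.
have : E' 0 < E' T - T by lra.
by move=> /k2; lra.
Qed.

End Comparison.

(** * The canonical flow *)

Section Positions.
Variables (R : realType) (m : nat) (nu : 'I_m -> R) (u : R) (tau taup : 'I_m -> R).
Variable i0 : 'I_m.
Hypotheses (nu0 : forall i, 0 < nu i) (u0 : 0 < u).
Local Notation s := (sorted_links tau taup).
Local Notation pos := (pos tau taup).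
Local Notation sg := (sig tau taup).
Local Notation nb := (nubar nu tau taup).
Local Notation k := (kidx nu u tau taup).
Local Notation th := (thstar nu u tau taup).

Lemma link_le_total : total (link_le tau taup).
Proof.
move=> i j; rewrite /link_le; case: (ltgtP (taup i) (taup j)) => //= _.
by case: (ltgtP (tau i) (tau j)) => //= _; exact: leq_total.
Qed.

Lemma size_sorted_links : size s = m.
Proof. by rewrite size_sort size_enum_ord. Qed.

Lemma mem_sorted_links i : i \in s.
Proof. by rewrite mem_sort mem_enum. Qed.

Lemma uniq_sorted_links : uniq s.
Proof. by rewrite sort_uniq enum_uniq. Qed.

Lemma sig_le p q : (0 < p)%N -> (p <= q)%N -> (q <= m)%N -> sg p <= sg q.
Proof.
case: p => // p _; case: q => // q pq qm.
have ss : sorted <=%R (map taup s).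
  rewrite sorted_map; apply: sub_sorted (sort_sorted link_le_total _) => i j.
  by rewrite /link_le /relpre /= => /orP[/ltW//|/andP[/eqP -> _]].
have := sorted_leq_nth le_trans (@lexx _ _) 0 ss.
by apply; rewrite ?inE ?size_map ?size_sorted_links// (leq_trans pq).
Qed.



Lemma pos_le i : (pos i <= m)%N.
Proof. by rewrite /Defs.pos -[leqRHS]size_sorted_links index_mem mem_sorted_links. Qed.

Lemma sig_pos i : sg (pos i) = taup i.
Proof.
rewrite /sig /= (nth_map i0) ?nth_index ?mem_sorted_links//.
by rewrite index_mem mem_sorted_links.
Qed.

Lemma nus_pos i : nus nu tau taup (pos i) = nu i.
Proof.
rewrite /nus /= (nth_map i0) ?nth_index ?mem_sorted_links//.
by rewrite index_mem mem_sorted_links.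
Qed.

Lemma ex_pos p : (0 < p)%N -> (p <= m)%N -> exists i, pos i = p.
Proof.
case: p => // p _ pm; exists (nth i0 s p).
by rewrite /Defs.pos index_uniq ?uniq_sorted_links// size_sorted_links.
Qed.

(** Sorting permutes the links, so a sum over positions can be reindexed by links. *)
Lemma nubarE j : (j <= m)%N -> nb j = capacity nu (fun i => (pos i <= j)%N).
Proof.
move=> jm; rewrite /nubar /capacity [RHS]big_mkcond.
rewrite [RHS](_ : _ = \sum_(i <- s) if (pos i <= j)%N then nu i else 0); last first.
  by apply: perm_big; rewrite perm_sym perm_sort enumT.
rewrite (big_nth i0) size_sorted_links big_add1 /=.
rewrite (big_cat_nat _ jm)//= [X in _ = _ + X]big1_seq ?addr0.
  rewrite big_seq [RHS]big_seq; apply: eq_bigr => p; rewrite mem_index_iota => /= pj.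
  rewrite -nus_pos /Defs.pos index_uniq ?uniq_sorted_links ?size_sorted_links ?(leq_trans pj)//.
move=> p /=; rewrite mem_index_iota => /andP[jp pm].
by rewrite /Defs.pos index_uniq ?uniq_sorted_links ?size_sorted_links// ltnNge jp.
Qed.

Lemma nubar_le j j' : (j <= j')%N -> (j' <= m)%N -> nb j <= nb j'.
Proof.
move=> jj' jm; rewrite !nubarE ?(leq_trans jj')//; apply: capacity_le => // i.
by move/leq_trans; apply.
Qed.

Lemma nubar_gt0 j : (0 < j)%N -> (j <= m)%N -> 0 < nb j.
Proof.
move=> j0 jm; rewrite nubarE// /capacity; have [i ij] := ex_pos j0 jm.
rewrite (bigD1 i) /= ?ij// ltr_pwDl// sumr_ge0// => i' _; exact: ltW.
Qed.

Lemma nubarS j : nb j.+1 = nb j + nus nu tau taup j.+1.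
Proof. by rewrite /nubar big_nat_recr. Qed.

Lemma nubar0 : nb 0 = 0.
Proof. by rewrite /nubar big_geq. Qed.

Lemma kidx_le : (k <= m)%N.
Proof. by apply/bigmax_leqP => j _; rewrite -ltnS. Qed.

Lemma nubar_kidx : nb k < u.
Proof.
(* The default value 0 of the maximum is itself admissible, since [nb 0 = 0 < u]. *)
apply: (big_ind (fun x => nb x < u)) => [|x y hx hy|j //]; first by rewrite nubar0.
by rewrite /maxn; case: ifP.
Qed.

Lemma le_kidx j : (j <= m)%N -> nb j < u -> (j <= k)%N.
Proof.
move=> jm ju; have jm1 : (j < m.+1)%N by [].
exact: (@leq_bigmax_cond _ (fun j : 'I_m.+1 => nb j < u) (fun j => j : nat) (Ordinal jm1) ju).
Qed.

Lemma nubar_lt j : (j <= k)%N -> nb j < u.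
Proof. by move=> jk; apply: le_lt_trans nubar_kidx; apply: nubar_le => //; exact: kidx_le. Qed.

Lemma nubar_kidxS : (k < m)%N -> u <= nb k.+1.
Proof.
by move=> km; rewrite leNgt; apply/negP => /(le_kidx km); rewrite ltnn.
Qed.

(* The real value of theta*_p; it differs from [thstar] only where the latter is infinite. *)
Definition breakpoint (p : nat) : R :=
  \sum_(1 <= i < p) nb i / (u - nb i) * (sg i.+1 - sg i).

Lemma breakpointS p : (0 < p)%N -> breakpoint p.+1 =
  breakpoint p + nb p / (u - nb p) * (sg p.+1 - sg p).
Proof. by move=> p0; rewrite /breakpoint big_nat_recr. Qed.

Lemma breakpoint1 : breakpoint 1 = 0.
Proof. by rewrite /breakpoint big_geq. Qed.

Lemma thstarE p : (0 < p)%N -> (p <= m)%N -> (p <= k.+1)%N -> th p = (breakpoint p)%:E.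
Proof.
case: p => // p _; elim: p => [|p IH] pm pk; first by rewrite breakpoint1.
rewrite [LHS]/= -/(th p.+1) pm nubar_lt// IH ?(ltnW pm) ?(ltnW pk)//.
by rewrite /= [in RHS]breakpointS.
Qed.

Lemma links_gt0 : (0 < m)%N.
Proof. by case: i0 => i; exact: leq_ltn_trans. Qed.

Lemma thstar_top : th m.+1 = +oo%E.
Proof.
have -> : th m.+1 = th m.-1.+2 by rewrite prednK// links_gt0.
by rewrite /= prednK ?links_gt0// ltnn.
Qed.

Lemma breakpoint_le p q : (0 < p)%N -> (p <= q)%N -> (q <= m)%N -> (q <= k.+1)%N ->
  breakpoint p <= breakpoint q.
Proof.
move=> p0 pq qm qk; rewrite /breakpoint (big_cat_nat (n := p) _ pq)//= lerDl.
rewrite big_seq sumr_ge0// => i; rewrite mem_index_iota => /andP[pi iq].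
have ik : (i <= k)%N by rewrite -ltnS (leq_trans iq).
have im : (i <= m)%N by rewrite (leq_trans (ltnW iq)).
apply: mulr_ge0; last by rewrite subr_ge0 sig_le ?(leq_trans p0 pi)// (leq_trans iq).
by rewrite divr_ge0 ?subr_ge0 ?ltW ?nubar_lt// nubar_gt0// (leq_trans p0).
Qed.

End Positions.

Section LipMore.
Variable R : realType.

Lemma lip_max (L : R) (g : R -> R) c : lip L g -> lip L (fun t => Num.max (g t) c).
Proof.
move=> lg s t st; apply: le_trans (lg _ _ st).
have h1 := ler_norm (g t - g s).
have h2 : - (g t - g s) <= `|g t - g s| by rewrite -normrN ler_norm.
have [?|?] := leP (g t) c; have [?|?] := leP (g s) c; rewrite ?subrr ?normr0//;
  by rewrite ler_norml; apply/andP; split; lra.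
Qed.

Lemma lip_min (L : R) (g : R -> R) c : lip L g -> lip L (fun t => Num.min (g t) c).
Proof.
move=> lg s t st; apply: le_trans (lg _ _ st).
have h1 := ler_norm (g t - g s).
have h2 : - (g t - g s) <= `|g t - g s| by rewrite -normrN ler_norm.
have [?|?] := leP (g t) c; have [?|?] := leP (g s) c; rewrite ?subrr ?normr0//;
  by rewrite ler_norml; apply/andP; split; lra.
Qed.

Lemma lipZ (L : R) (g : R -> R) c : lip L g -> lip (`|c| * L) (fun t => c * g t).
Proof.
by move=> lg s t st; rewrite -mulrBr normrM -mulrA ler_wpM2l// lg.
Qed.

Lemma lip_sum (r : seq nat) (L : nat -> R) (g : nat -> R -> R) :
  (forall j, lip (L j) (g j)) -> lip (\sum_(j <- r) L j) (fun t => \sum_(j <- r) g j t).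
Proof.
move=> lg s t st; rewrite -sumrB mulr_suml.
apply: le_trans (ler_norm_sum _ _ _) _; apply: ler_sum => j _; exact: lg.
Qed.

End LipMore.

(** * Delay of the canonical flow *)

Section Waiting.
Variables (R : realType) (m : nat) (nu : 'I_m -> R) (u : R) (tau taup : 'I_m -> R).
Variable i0 : 'I_m.
Hypotheses (nu0 : forall i, 0 < nu i) (u0 : 0 < u).
Local Notation pos := (pos tau taup).
Local Notation sg := (sig tau taup).
Local Notation nb := (nubar nu tau taup).
Local Notation k := (kidx nu u tau taup).
Local Notation bp := (breakpoint nu u tau taup).

(* The delay of the canonical flow grows with slope (u - nubar j) / nubar j on
   [theta*_j, theta*_(j+1)]; written as a sum of clipped ramps it is visibly Lipschitz. *)
Definition wait_slope (j : nat) : R := (u - nb j) / nb j.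

(** Time spent in the piece number [j] up to [t]. The piece [j = m] has no right end, hence the case
    distinction. *)
Definition ramp (j : nat) (t : R) : R :=
  Num.max ((if (j < m)%N then Num.min t (bp j.+1) else t) - bp j) 0.

Definition canonical_wait (t : R) : R := sg 1 + \sum_(1 <= j < k.+1) wait_slope j * ramp j t.

Lemma lip_canonical_wait : exists K, lip K canonical_wait.
Proof.
have lramp j : lip (1 + 0) (ramp j).
  apply: lip_max; apply: lipD; last exact: lip_cst.
  have lid : lip 1 (fun t : R => t) by move=> s t st; rewrite mul1r ger0_norm// subr_ge0.
  by case: (j < m)%N => //; exact: lip_min.
exists (0 + \sum_(1 <= j < k.+1) `|wait_slope j| * (1 + 0)).
apply: lipD; first exact: lip_cst.
by apply: lip_sum => j; apply: lipZ; exact: lramp.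
Qed.

Let km : (k <= m)%N := kidx_le nu u tau taup.

Let nb_lt j : (j <= k)%N -> nb j < u := @nubar_lt _ _ _ _ _ _ i0 nu0 u0 j.

Let nb_gt0 j : (0 < j)%N -> (j <= m)%N -> 0 < nb j := @nubar_gt0 _ _ _ _ _ i0 nu0 j.

Let bp_le p q : (0 < p)%N -> (p <= q)%N -> (q <= m)%N -> (q <= k.+1)%N -> bp p <= bp q.
Proof. exact: breakpoint_le. Qed.

Lemma ramp_full j t : (0 < j)%N -> (j <= k)%N -> (j < m)%N -> bp j.+1 <= t ->
  wait_slope j * ramp j t = sg j.+1 - sg j.
Proof.
move=> j0 jk jm bt; have b1 : bp j <= bp j.+1 by apply: bp_le.
rewrite /ramp jm min_r// max_l ?subr_ge0// (breakpointS _ _ _ _ j0) /wait_slope.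
have n0 : nb j != 0 by rewrite gt_eqF// nb_gt0// ltnW.
have n1 : u - nb j != 0 by rewrite gt_eqF// subr_gt0 nb_lt.
by field; rewrite n0 n1.
Qed.

Lemma ramp_full_sum p t : (0 < p)%N -> (p <= m)%N -> (p <= k.+1)%N -> bp p <= t ->
  \sum_(1 <= j < p) wait_slope j * ramp j t = sg p - sg 1.
Proof.
move=> p0 pm pk bt; rewrite -telescope_sumr//; apply: eq_big_nat => j /andP[j0 jp].
apply: ramp_full => //.
- by rewrite -ltnS (leq_trans jp).
- exact: leq_trans pm.
- by apply: le_trans bt; apply: bp_le.
Qed.

(** Earlier ramps are complete and telescope to [sg j - sg 1]; later ones have not started. *)
Lemma canonical_wait_piece j t : (0 < j)%N -> (j <= k)%N -> bp j <= t ->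
  ((j < m)%N -> t <= bp j.+1) -> canonical_wait t = sg j + wait_slope j * (t - bp j).
Proof.
move=> j0 jk jt tj; have jm : (j <= m)%N := leq_trans jk km.
rewrite /canonical_wait (big_cat_nat (n := j))//=; last exact: leqW.
rewrite ramp_full_sum//; last exact: leqW.
rewrite big_ltn// [X in _ + (_ + (_ + X))]big1_seq => [|i]; last first.
  rewrite mem_index_iota => /= /andP[ji ik].
  have jm' : (j < m)%N by apply: leq_trans km; apply: leq_trans ji _.
  rewrite /ramp max_r ?mulr0// subr_le0; apply: (@le_trans _ _ t).
    by case: ifP => // _; rewrite ge_min lexx.
  apply: le_trans (tj jm') _; apply: bp_le => //; last exact: ltnW.
  exact: leq_trans km.
rewrite addr0 (_ : ramp j t = t - bp j); first by ring.
rewrite /ramp; case: ifP => [/tj tj'|_]; first by rewrite min_l// max_l// subr_ge0.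
by rewrite max_l// subr_ge0.
Qed.

Lemma canonical_wait_plateau t : (k < m)%N -> bp k.+1 <= t -> canonical_wait t = sg k.+1.
Proof. by move=> kltm bt; rewrite /canonical_wait ramp_full_sum//; ring. Qed.

Lemma canonical_wait0 : canonical_wait 0 = sg 1.
Proof.
rewrite /canonical_wait big1_seq ?addr0// => j; rewrite mem_index_iota => /= /andP[j0 jk].
have bj : 0 <= bp j.
  rewrite -(breakpoint1 nu u tau taup); apply: bp_le => //; last exact: ltnW.
  exact: leq_trans km.
rewrite /ramp max_r ?mulr0// subr_le0; apply: le_trans bj.
by case: ifP => // _; rewrite ge_min lexx.
Qed.

Lemma slope_gt0 j : (0 < j)%N -> (j <= k)%N -> 0 < wait_slope j.
Proof.
move=> j0 jk; rewrite /wait_slope divr_gt0 ?subr_gt0 ?nb_lt//.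
by rewrite nb_gt0// (leq_trans jk km).
Qed.

Lemma canonical_wait_le j t : (0 < j)%N -> (j <= k)%N -> (j < m)%N -> bp j <= t -> t <= bp j.+1 ->
  canonical_wait t <= sg j.+1.
Proof.
move=> j0 jk jm jt tj; rewrite (canonical_wait_piece j0 jk jt) => [|_//].
have := ramp_full j0 jk jm (lexx _).
rewrite /ramp jm minxx max_l ?subr_ge0 ?bp_le// => E.
have : wait_slope j * (t - bp j) <= wait_slope j * (bp j.+1 - bp j).
  by rewrite ler_pM2l ?slope_gt0//; lra.
by lra.
Qed.

Lemma piece_cases t : 0 <= t -> ((k < m)%N /\ bp k.+1 <= t) \/
  exists j, [/\ (0 < j)%N, (j <= k)%N, bp j <= t & (j < m)%N -> t < bp j.+1].
Proof.
move=> t0; have [/andP[? ?]|nB] := boolP ((k < m)%N && (bp k.+1 <= t)); first by left.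
right; pose Q j := (0 < j <= k)%N && (bp j <= t).
have Q1 : exists j, Q j.
  (* If [k = 0], the plateau starts at [bp 1 = 0] and the first alternative would already hold. *)
  exists 1%N; rewrite /Q breakpoint1 t0 andbT /= lt0n; apply/eqP => k0.
  by move: nB; rewrite k0 breakpoint1 t0 andbT (links_gt0 i0).
have Qk j : Q j -> (j <= k)%N by move=> /andP[/andP[]].
have [j /andP[/andP[j0 jk] jt] jmax] := ex_maxnP Q1 Qk.
exists j; split=> // jm; rewrite ltNge; apply/negP => bt.
have [jk'|kj] := ltnP j k.
  by have := jmax j.+1; rewrite /Q jk' bt /= ltnn => /(_ isT).
have E : j = k by apply/eqP; rewrite eqn_leq jk.
by move: nB; rewrite -E jm bt.
Qed.

Local Notation th := (thstar nu u tau taup).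

Lemma thstar_gt j t : (0 < j)%N -> (j <= k)%N -> ((j < m)%N -> t < bp j.+1) ->
  (t%:E < th j.+1)%E.
Proof.
move=> j0 jk tj; have [jm|mj] := ltnP j m; first by rewrite thstarE// lte_fin tj.
have -> : j = m by apply/eqP; rewrite eqn_leq mj (leq_trans jk km).
by rewrite (thstar_top _ _ _ _ i0) ltry.
Qed.

Lemma canonical_flow_piece j t i : (0 < j)%N -> (j <= k)%N -> bp j <= t ->
  ((j < m)%N -> t < bp j.+1) ->
  canonical_flow nu u tau taup i t = if (pos i <= j)%N then u / nb j * nu i else 0.
Proof.
move=> j0 jk jt tj; have jm : (j <= m)%N := leq_trans jk km.
have Hk : (th k.+1 <= t%:E)%E = false.
  apply/negbTE; rewrite -ltNge; apply: thstar_gt => //; first exact: leq_trans jk.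
  move=> kltm; have jm' : (j < m)%N := leq_ltn_trans jk kltm.
  by apply: lt_le_trans (tj jm') _; apply: bp_le.
rewrite /canonical_flow Hk andbF; case: ifP => [pk|/negbT]; last first.
  by rewrite -ltnNge => kp; rewrite leqNgt (leq_ltn_trans jk kp).
(* The half-open pieces are disjoint even when breakpoints coincide, so only the term [j' = j]
   survives. *)
rewrite (eq_big_nat _ _ (F2 := fun j' => if j' == j then u / nb j * nu i else 0)).
  by rewrite -big_mkcond big_nat1_eq ltnS jk andbT.
move=> j' /andP[pj' j'k]; have j'0 : (0 < j')%N by apply: leq_trans pj'.
have j'm : (j' <= m)%N by apply: leq_trans km.
rewrite thstarE ?(leqW j'k)//; last exact: ltnW.
rewrite lee_fin; have [->|ne] := eqVneq j' j; first by rewrite jt thstar_gt.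
have [lt|gt|E] := ltngtP j' j; last by rewrite E eqxx in ne.
  rewrite thstarE//; last exact: leq_trans jm.
  rewrite lte_fin [X in _ && X]ltNge (_ : bp j'.+1 <= t) ?andbF//.
  by apply: le_trans jt; apply: bp_le => //; exact: leqW.
rewrite [X in X && _]leNgt (_ : t < bp j')//.
have jm' : (j < m)%N := leq_trans gt j'm.
by apply: lt_le_trans (tj jm') _; apply: bp_le => //; exact: ltnW.
Qed.

Lemma canonical_flow_plateau t i : (k < m)%N -> bp k.+1 <= t ->
  canonical_flow nu u tau taup i t =
    if (pos i <= k)%N then nu i else if pos i == k.+1 then u - nb k else 0.
Proof. by move=> kltm bt; rewrite /canonical_flow thstarE// lee_fin bt kltm !andbT. Qed.

End Waiting.

(** * The canonical flow is an equilibrium *)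

Section CanonicalEquilibrium.
Variables (R : realType) (m : nat) (nu : 'I_m -> R) (u : R) (tau taup : 'I_m -> R).
Variable i0 : 'I_m.
Hypotheses (nu0 : forall i, 0 < nu i) (u0 : 0 < u).
Local Notation mu := (@lebesgue_measure R).
Local Notation pos := (pos tau taup).
Local Notation sg := (sig tau taup).
Local Notation nb := (nubar nu tau taup).
Local Notation k := (kidx nu u tau taup).
Local Notation bp := (breakpoint nu u tau taup).
Local Notation th := (thstar nu u tau taup).
Local Notation cf := (canonical_flow nu u tau taup).
Local Notation c := (canonical_wait nu u tau taup).
Local Notation slope := (wait_slope nu u tau taup).

Let km : (k <= m)%N := kidx_le nu u tau taup.

Let nb_lt j : (j <= k)%N -> nb j < u := @nubar_lt _ _ _ _ _ _ i0 nu0 u0 j.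

Let nb_gt0 j : (0 < j)%N -> (j <= m)%N -> 0 < nb j := @nubar_gt0 _ _ _ _ _ i0 nu0 j.

Let taupE i : taup i = sg (pos i).
Proof. by rewrite sig_pos. Qed.

Lemma pos_inj : injective pos.
Proof.
move=> i j []; rewrite -{2}(nth_index i0 (mem_sorted_links tau taup i)) => ->.
by rewrite nth_index// mem_sorted_links.
Qed.

Lemma canonical_wait_ge j t : (0 < j)%N -> (j <= k)%N -> bp j <= t ->
  ((j < m)%N -> t <= bp j.+1) -> sg j <= c t.
Proof.
move=> j0 jk jt tj; rewrite (canonical_wait_piece i0 nu0 u0 j0 jk jt tj) lerDl mulr_ge0 ?subr_ge0//.
by rewrite ltW// slope_gt0.
Qed.

Lemma canonical_flow_ge0 i t : 0 <= t -> 0 <= cf i t.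
Proof.
move=> t0; have [[kltm bt]|[j [j0 jk jt tj]]] := piece_cases nu u tau taup i0 t0.
  rewrite (canonical_flow_plateau nu0 u0)//; case: ifP => _; first exact: ltW.
  by case: ifP => // _; rewrite subr_ge0 ltW// nb_lt.
rewrite (canonical_flow_piece i0 nu0 u0 _ j0 jk jt tj); case: ifP => // _.
by rewrite mulr_ge0 ?divr_ge0 ?ltW// nb_gt0// (leq_trans jk km).
Qed.

Lemma canonical_flow_sum t : 0 <= t -> \sum_(i < m) cf i t = u.
Proof.
move=> t0; have [[kltm bt]|[j [j0 jk jt tj]]] := piece_cases nu u tau taup i0 t0.
  have [i1 pi1] := ex_pos tau taup i0 (ltn0Sn k) kltm.
  rewrite (eq_bigr (fun i => (if (pos i <= k)%N then nu i else 0) +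
                             (if i == i1 then u - nb k else 0))); last first.
    move=> i _; rewrite (canonical_flow_plateau nu0 u0)// -pi1 (inj_eq pos_inj).
    have [->|] := eqVneq i i1; first by rewrite pi1 ltnn add0r.
    by case: ifP; rewrite addr0.
  rewrite big_split /= -!big_mkcond /= big_pred1_eq -/(capacity nu _) -nubarE//.
  by rewrite subrKC.
rewrite (eq_bigr (fun i => if (pos i <= j)%N then u / nb j * nu i else 0)); last first.
  by move=> i _; exact: (canonical_flow_piece i0 nu0 u0 _ j0 jk jt tj).
have jm : (j <= m)%N by rewrite (leq_trans jk km).
rewrite -big_mkcond -mulr_sumr -/(capacity nu _) -nubarE// divfK//.
by rewrite gt_eqF// nb_gt0.
Qed.

Lemma canonical_flow_used i t : 0 <= t -> 0 < cf i t -> taup i <= c t.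
Proof.
move=> t0; have [[kltm bt]|[j [j0 jk jt tj]]] := piece_cases nu u tau taup i0 t0.
  rewrite (canonical_flow_plateau nu0 u0)// (canonical_wait_plateau i0)// taupE.
  case: ifP => [pk _|_]; first by rewrite sig_le// leqW.
  by case: ifP => [/eqP -> //|_]; rewrite ltxx.
rewrite (canonical_flow_piece i0 nu0 u0 _ j0 jk jt tj) taupE; case: ifP => [pj _|_]; last by rewrite ltxx.
apply: (@le_trans _ _ (sg j)); first by rewrite sig_le// (leq_trans jk km).
by apply: canonical_wait_ge => // /tj /ltW.
Qed.

Lemma measurable_thstar_le (x : \bar R) :
  measurable_fun [set: R] (fun t : R => (x <= t%:E)%E).
Proof.
apply: (@measurable_fun_bool _ _ _ _ true); rewrite setTI.
case: x => [r||].
- rewrite (_ : _ @^-1` _ = `[r, +oo[%classic); first exact: measurable_itv.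
  by apply/seteqP; split=> t; rewrite /= lee_fin in_itv/= andbT.
- rewrite (_ : _ @^-1` _ = set0); first exact: measurable0.
  by apply/seteqP; split=> t //=; rewrite leye_eq.
- rewrite (_ : _ @^-1` _ = setT); first exact: measurableT.
  by apply/seteqP; split=> t //= _; rewrite leNye.
Qed.

Lemma measurable_canonical_flow i : measurable_fun [set: R] (cf i).
Proof.
have mle := measurable_thstar_le.
have mlt x : measurable_fun [set: R] (fun t : R => (t%:E < x)%E).
  rewrite (_ : (fun t : R => (t%:E < x)%E) = (fun t : R => ~~ (x <= t%:E)%E)).
    by apply: measurable_neg; exact: mle.
  by apply/funext => t; rewrite ltNge.
rewrite /canonical_flow /=; case: (pos i <= k)%N.
  apply: measurable_fun_ifT; [exact: mle|exact: measurable_cst|].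
  apply: measurable_sum => j; apply: measurable_fun_ifT; last 2 first.
  - exact: measurable_cst.
  - exact: measurable_cst.
  by apply: measurable_and; [exact: mle|exact: mlt].
case: ((pos i == k.+1) && (k < m)%N) => /=; last exact: measurable_cst.
by apply: measurable_fun_ifT; [exact: mle|exact: measurable_cst|exact: measurable_cst].
Qed.

Let affine_derive (g : R -> R) (t d r : R) : 0 < r ->
  (forall h, `|h| < r -> g (t + h) = g t + d * h) -> derivable g t 1 /\ derive1 g t = d.
Proof.
move=> r0 H; apply/derivable_approxP => e e0; exists r => // h /H ->.
have -> : g t + d * h - g t - d * h = 0 by ring.
by rewrite normr0 mulr_ge0// ltW.
Qed.

(** The queue formula of an equilibrium with delay [c] is checked directly: off the countably many
    breakpoints, [c] is affine around [t]. *)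
Lemma canonical_queue i : is_queue nu cf i (fun t => nu i * Num.max (c t - taup i) 0).
Proof.
set z := (z in is_queue _ _ _ z).
have [K lK] := lip_canonical_wait nu u tau taup.
have lz : exists L, lip L z.
  exists (`|nu i| * (K + 0)); apply: lipZ; apply: lip_max.
  by apply: lipD lK _; apply: lip_cst.
have [L lL] := lz.
split; first by rewrite /z canonical_wait0// max_r ?mulr0// subr_le0 taupE sig_le// pos_le.
split; first by move=> b b0; exact: lip_abs_cont lL.
have nbp : {ae mu, forall t : R, forall p, t <> bp p}.
  apply/ae_foralln => p; exists [set bp p]; split => //.
    exact: lebesgue_measure_set1.
  by move=> t /= /contrapT.
apply: aeS nbp => t nbpt t0.
have [[kltm bt]|[j [j0 jk jt tj]]] := piece_cases nu u tau taup i0 (ltW t0).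
  have bt' : bp k.+1 < t by rewrite lt_neqAle bt andbT; apply/eqP/nesym.
  have ct : c t = sg k.+1 by apply: canonical_wait_plateau.
  have [||dz ->] := @affine_derive z t 0 (t - bp k.+1).
    - by rewrite subr_gt0.
    - move=> h; rewrite ltr_norml => /andP[h1 _].
      by rewrite mul0r addr0 /z !(canonical_wait_plateau i0)//; lra.
  split=> //; rewrite (canonical_flow_plateau nu0 u0)// /z ct.
  (* On the plateau an empty link must take in at most its capacity. For position [k.+1] this is the
     maximality of [k]; a link with a queue has position at most [k] and inflow exactly [nu i]. *)
  have [cle|clt] := leP (sg k.+1) (taup i).
    right; rewrite max_r ?mulr0 ?subr_le0//; split=> //; apply/esym/max_r.
    case: ifP => _; first by rewrite subrr.
    case: ifP => [/eqP pk|_]; last by rewrite sub0r oppr_le0 ltW.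
    have := nubar_kidxS kltm; rewrite nubarS -pk nus_pos// /Defs.pos => ?; lra.
  left; have -> : (pos i <= k)%N.
    rewrite leqNgt; apply/negP => kp; move: clt; rewrite taupE ltNge => /negP; apply.
    by apply: sig_le => //; exact: pos_le.
  by rewrite subrr; split=> //; rewrite mulr_gt0// lt_max subr_gt0 clt.
have jm : (j <= m)%N by rewrite (leq_trans jk km).
have jt' : bp j < t by rewrite lt_neqAle jt andbT; apply/eqP/nesym.
pose r := Num.min (t - bp j) (if (j < m)%N then bp j.+1 - t else 1).
have r0 : 0 < r.
  by rewrite /r lt_min subr_gt0 jt' /=; case: ifP => // /tj; rewrite subr_gt0.
have near_t h : `|h| < r -> bp j <= t + h /\ ((j < m)%N -> t + h <= bp j.+1).
  rewrite /r lt_min !ltr_norml => /andP[/andP[h1 _] /andP[_ h2]].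
  by split; [lra|move=> jm'; move: h2; rewrite jm'; lra].
have cE h : `|h| < r -> c (t + h) = c t + slope j * h.
  move=> /near_t[n1 n2]; rewrite !(canonical_wait_piece i0 nu0 u0 j0 jk)//; first by ring.
  by move=> /tj/ltW.
rewrite (canonical_flow_piece i0 nu0 u0 _ j0 jk jt tj); case: ifP => [pj|/negbT]; last first.
  rewrite -ltnNge => jp; have jm' : (j < m)%N by rewrite (leq_trans jp)// pos_le.
  (* During piece [j] the delay stays at most [sg j.+1], so links in later positions have no
     queue. *)
  have z0 h : `|h| < r -> z (t + h) = 0.
    move=> /near_t[n1 n2]; rewrite /z max_r ?mulr0// subr_le0 taupE.
    apply: (le_trans (canonical_wait_le i0 nu0 u0 j0 jk jm' n1 (n2 jm'))).
    by apply: sig_le => //; exact: pos_le.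
  have zt : z t = 0 by rewrite -(addr0 t) z0// normr0.
  have [||dz ->] := @affine_derive z t 0 r.
    - by [].
    - by move=> h hr; rewrite z0// zt mul0r addr0.
  split=> //; right; split=> //; apply/esym/max_r.
  by rewrite sub0r oppr_le0 ltW.
have cge h : `|h| < r -> taup i <= c (t + h).
  move=> /near_t[n1 n2]; apply: (@le_trans _ _ (sg j)); first by rewrite taupE sig_le.
  exact: canonical_wait_ge.
have [||dz ->] := @affine_derive z t (u / nb j * nu i - nu i) r.
  - by [].
  - move=> h hr; rewrite /z !max_l ?subr_ge0; last 2 first.
      by have := cge 0; rewrite addr0 normr0; apply.
      exact: cge.
    rewrite cE// /wait_slope; field.
    by rewrite gt_eqF// nb_gt0.
split=> //; left; split=> //; rewrite /z mulr_gt0// lt_max subr_gt0; apply/orP; left.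
rewrite (canonical_wait_piece i0 nu0 u0 j0 jk jt (fun jm => ltW (tj jm))).
have : 0 < slope j * (t - bp j) by rewrite mulr_gt0 ?subr_gt0// slope_gt0.
have : taup i <= sg j by rewrite taupE sig_le.
by lra.
Qed.

Lemma canonical_flow_is_flow : is_flow u cf.
Proof.
split=> [i|]; first exact: measurable_funS (measurable_canonical_flow i).
split=> [i t|]; first exact: canonical_flow_ge0.
by apply: aeW => t; exact: canonical_flow_sum.
Qed.

Lemma canonical_is_equilibrium : is_equilibrium nu u taup cf.
Proof.
split; first exact: canonical_flow_is_flow.
have qE i t : 0 <= t -> queue nu cf i t = nu i * Num.max (c t - taup i) 0.
  move=> t0; apply: is_queue_unique (canonical_queue i) t t0.
  exact: (@xgetPex _ (fun=> 0) [set z | is_queue nu cf i z] (ex_intro _ _ (canonical_queue i))).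
(* In this form the minimum over links is attained wherever [taup i <= c t], which holds on links in
   use. *)
have exitE i t : 0 <= t -> exit_time nu taup cf i t = t + Num.max (c t) (taup i).
  move=> t0; rewrite /exit_time qE// [nu i * _]mulrC mulfK ?gt_eqF//.
  by rewrite -addrA addr_maxl subrK add0r.
apply: aeW => t t0 i fi; apply/le_anti/andP; split; last exact: bigmin_le.
apply: le_bigmin => [|j _]; first exact: leey.
rewrite lee_fin !exitE// lerD2l (max_l (canonical_flow_used t0 fi)).
by rewrite le_max lexx.
Qed.

End CanonicalEquilibrium.

(** * Makespan *)

Section Makespan.
Variables (R : realType) (m : nat) (nu : 'I_m -> R) (u : R) (tau : 'I_m -> R).
Local Notation mu := (@lebesgue_measure R).
Hypotheses (nu0 : forall i, 0 < nu i) (u0 : 0 < u).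

Lemma exit_time_used (tau' tau0 : 'I_m -> R) f F E i t :
  equilibrium_profile nu u tau' f F E -> 0 <= t -> tau' i <= E t - t ->
  exit_time nu tau0 f i t = E t - tau' i + tau0 i.
Proof.
move=> prof t0 used; rewrite /exit_time (profile_queue prof)// max_l ?subr_ge0//.
by field; rewrite gt_eqF.
Qed.

Lemma makespan_le_profile f F E (T : R) : equilibrium_profile nu u tau f F E ->
  (makespan nu tau T f <= (E T)%:E)%E.
Proof.
move=> prof; apply: ereal_inf_lbound => /=.
apply: aeS (profile_used prof) => t ut /andP[t0 tT] i fi.
rewrite lee_fin (exit_time_used tau prof t0 (ut t0 i fi)) subrK.
by rewrite (profile_mono prof)// t0.
Qed.

Lemma makespan_ge_profile (tau' : 'I_m -> R) f F E f' F' E' (T : R) : 0 < T ->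
  equilibrium_profile nu u tau f F E -> equilibrium_profile nu u tau' f' F' E' ->
  ((E T)%:E <= makespan nu tau T f')%E.
Proof.
move=> T0 prof prof'; apply: le_ereal_inf_tmp => M /= HM.
have real_case (r : R) : {ae mu, forall t : R, 0 <= t <= T -> forall i, 0 < f' i t ->
    exit_time nu tau f' i t <= r} -> E T <= r.
  move=> Hr; apply: (makespan_lower_bound nu0 u0 prof prof' T0).
  apply: aeS2 Hr (profile_used prof') => t Ht ut tT i fi.
  have /andP[t0 _] := tT.
  by rewrite -(exit_time_used tau prof' t0 (ut t0 i fi)); exact: Ht.
case: M HM => [r||] HM.
- by rewrite lee_fin; apply: real_case; apply: aeS HM => t Ht tT i fi; rewrite -lee_fin Ht.
- by rewrite leey.
(* The bound [-oo] would mean that almost no particle enters up to [T]; then every real number would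
   be a bound, [E T - 1] included. *)
- exfalso; suff : E T <= E T - 1 by lra.
  apply: real_case; apply: aeS HM => t Ht tT i fi.
  by have := Ht tT i fi; rewrite leeNy_eq.
Qed.

(** The exit times [E] and [E'] of two equilibria are compared only through makespans: that of [f']
    is at most [E' T], which is at most that of [f], which is at most [E T], which is at most that
    of [f']. *)
Lemma makespan_unique f F E f' (T : R) : 0 < T ->
  equilibrium_profile nu u tau f F E -> is_equilibrium nu u tau f' ->
  makespan nu tau T f' = (E T)%:E.
Proof.
move=> T0 prof eqf'; have [F' [E' prof']] := equilibrium_has_profile nu0 u0 eqf'.
apply/le_anti/andP; split; last exact: (makespan_ge_profile T0 prof prof').
apply: le_trans (makespan_le_profile T prof') _.
apply: le_trans (makespan_le_profile T prof).
exact: (makespan_ge_profile T0 prof' prof).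
Qed.

End Makespan.

Theorem mainTheorem4 (R : realType) (m : nat) (nu : 'I_m -> rat) (u : rat)
  (tau : 'I_m -> rat) (T : R) (f : 'I_m -> R -> R) :
  (forall i, 0 < nu i) -> 0 < u -> (forall i, 0 <= tau i) -> 0 < T ->
  is_equilibrium (fun i => ratr (nu i)) (ratr u) (fun i => ratr (tau i)) f ->
  let nuR : 'I_m -> R := fun i => ratr (nu i) in
  let uR : R := ratr u in
  let tauR : 'I_m -> R := fun i => ratr (tau i) in
  let Mbar := upper_makespan nuR uR tauR T in
  let infMbar := ereal_inf [set Mbar t' | t' in [set t' : 'I_m -> R | forall i, 0 <= t' i]] in
  (exists2 t0 : 'I_m -> R, (forall i, 0 <= t0 i) & Mbar t0 = infMbar) /\
  makespan nuR tauR T f = lower_makespan nuR uR tauR T tauR /\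
  lower_makespan nuR uR tauR T tauR = Mbar tauR /\
  Mbar tauR = infMbar.
Proof.
move=> nu0 u0 tau0 T0 eqf nuR uR tauR Mbar infMbar.
have nuR0 i : 0 < nuR i by rewrite /nuR ltr0q.
have uR0 : 0 < uR by rewrite /uR ltr0q.
have tauR0 i : 0 <= tauR i by rewrite /tauR ler0q.
have [i0 _] := flow_link uR0 (proj1 eqf).
have [F [E prof]] := equilibrium_has_profile nuR0 uR0 eqf.
have canon tau' := canonical_is_equilibrium tauR tau' i0 nuR0 uR0.
have low : lower_makespan nuR uR tauR T tauR = (E T)%:E.
  exact: (makespan_unique nuR0 uR0 T0 prof (canon tauR)).
have Mf : makespan nuR tauR T f = (E T)%:E := makespan_unique nuR0 uR0 T0 prof eqf.
have up : Mbar tauR = (E T)%:E.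
  apply/le_anti/andP; split.
    by apply: ge_ereal_sup => _ [g eqg <-]; rewrite (makespan_unique nuR0 uR0 T0 prof eqg).
  by rewrite -Mf; apply: ereal_sup_ubound; exists f.
have inf : infMbar = (E T)%:E.
  apply/le_anti/andP; split; first by rewrite -up; apply: ereal_inf_lbound; exists tauR.
  apply: le_ereal_inf_tmp => _ [tau' _ <-].
  (* One equilibrium for [tau'] suffices to bound the supremum from below; over an empty set it
     would be [-oo]. *)
  have [F' [E' prof']] := equilibrium_has_profile nuR0 uR0 (canon tau').
  apply: le_trans (makespan_ge_profile nuR0 uR0 T0 prof prof') _.
  by apply: ereal_sup_ubound; exists (canonical_flow nuR uR tauR tau') => //; exact: canon.
split; first by exists tauR => //; rewrite up inf.
by rewrite Mf low up inf.
Qed.
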